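(* Let $\mathcal I$ be an index set. For each $k\in\mathcal I$ and $n\in\mathbb N$, let $A_{k,n}\subset\mathbb N$ with $|A_{k,n}|=n$, and let $r_{k,n}\in\mathbb N$, $r_{k,n}\le n$, satisfy $\lim_{n\to\infty}\frac{r_{k,n}}{n}=0$; assume that for each $k$ the integers $r_{k,n}$, $n\in\mathbb N$, all have the same parity. Let $$H_{k,n}=\frac{(\sqrt{-1})^{\lfloor r_{k,n}/2\rfloor}}{\binom{n}{r_{k,n}}^{1/2}}\sum_{\substack{i_1<\cdots<i_{r_{k,n}}\\ i_1,\dots,i_{r_{k,n}}\in A_{k,n}}}J_{k;i_1,\dots,i_{r_{k,n}}}\,\psi_{i_1}\cdots\psi_{i_{r_{k,n}}},$$ where the $J_{k;i_1,\dots,i_{r_{k,n}}}$ are independent (real) random variables with $\mathbb E[J_{k;i_1,\dots,i_{r_{k,n}}}]=0$, $\mathbb E[J_{k;i_1,\dots,i_{r_{k,n}}}^2]=1$, and such that for each integer $p\ge 3$ there is a constant $C_p<\infty$ with $|\mathbb E[J_{k;i_1,\dots,i_{r_{k,n}}}^p]|\le C_p$ (for all of these variables), and where the $\psi_i$ are Majorana fermions satisfying $\psi_i\psi_j+\psi_j\psi_i=2\delta_{i,j}$. If for all $i,j\in\mathcal I$ $$\lim_{n\to\infty}\frac{r_{i,n}r_{j,n}}{n}\cdot\frac{|A_{i,n}\cap A_{j,n}|}{n}=\lambda_{i,j}\in[0,\infty],$$ then $\{H_{k,n}\mid k\in\mathcal I\}$ converges in distribution, as $n\to\infty$, to $\{s_k\mid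 k\in\mathcal I\}$; that is, for all $d\in\mathbb N$ and $k_1,\dots,k_d\in\mathcal I$, $$\lim_{n\to\infty}\mathbb E\left[\operatorname{tr}\left(H_{k_1,n}\cdots H_{k_d,n}\right)\right]=\tau_{\mathcal H}(s_{k_1}\cdots s_{k_d}),$$ where $\{s_k\mid k\in\mathcal I\}$ is a $Q=(q_{i,j})$-system (mixed $q$-Gaussian system) with $q_{i,j}=(-1)^{r_{i,n}r_{j,n}}e^{-2\lambda_{i,j}}$.
   Context: $\mathbb N=\{1,2,\dots\}$ and $e^{-\infty}=0$. The sign $(-1)^{r_{i,n}r_{j,n}}$ does not depend on $n$ by the parity assumption. Majorana fermions are self-adjoint elements $\psi_i$ ($i\in\mathbb N$) of a unital $*$-algebra with $\psi_i\psi_j+\psi_j\psi_i=2\delta_{i,j}$; $\operatorname{tr}$ is the normalized trace on the algebra they generate (so $\operatorname{tr}(1)=1$ and $\operatorname{tr}(\psi_{i_1}\cdots\psi_{i_r})=0$ for $i_1<\cdots<i_r$, $r\ge1$). For each $n$, independence is over all $k\in\mathcal I$ and all index tuples. Mixed $q$-Gaussian system: let $Q=(q_{i,j})_{i,j\in\mathcal I}$ be a real symmetric matrix with $|q_{i,j}|\le1$, let $\mathcal H$ be a Hilbert space with orthonormal basis $\{e_i\mid i\in\mathcal I\}$, and let $\mathcal F_{\mathrm{alg}}(\mathcal H)$ be the algebraic full Fock space spanned by the vacuum $\Omega$ and the tensors $e_{j_1}\otimes\cdots\otimes e_{j_n}$, $n\ge1$. It carries the positive semidefinite form $\langle\cdot,\cdot\rangle_Q$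 for which $\Omega$ is a unit vector, tensors of different lengths are orthogonal, and $$\langle e_{i_1}\otimes\cdots\otimes e_{i_n},e_{j_1}\otimes\cdots\otimes e_{j_n}\rangle_Q=\sum_{k=1}^n\delta_{i_1,j_k}q_{i_1,j_1}\cdots q_{i_1,j_{k-1}}\langle e_{i_2}\otimes\cdots\otimes e_{i_n},e_{j_1}\otimes\cdots\otimes e_{j_{k-1}}\otimes e_{j_{k+1}}\otimes\cdots\otimes e_{j_n}\rangle_Q .$$ The left creation and annihilation operators are $l_i\Omega=e_i$, $l_i(e_{j_1}\otimes\cdots\otimes e_{j_n})=e_i\otimes e_{j_1}\otimes\cdots\otimes e_{j_n}$; $l_i^*\Omega=0$, $l_i^*(e_{j_1}\otimes\cdots\otimes e_{j_n})=\sum_{k=1}^n\delta_{i,j_k}q_{i,j_1}\cdots q_{i,j_{k-1}}e_{j_1}\otimes\cdots\otimes e_{j_{k-1}}\otimes e_{j_{k+1}}\otimes\cdots\otimes e_{j_n}$. Put $s_i=l_i+l_i^*$ and $\tau_{\mathcal H}(a)=\langle a\Omega,\Omega\rangle_Q$. The family $\{s_i\}$ with $\tau_{\mathcal H}$ is the $Q$-system. *)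

(* Defs.v *)
From HB Require Import structures.
From mathcomp Require Import all_boot all_order all_algebra finmap.
From mathcomp Require Import all_classical all_reals all_analysis.
From mathcomp Require Import complex freeg.

Set Implicit Arguments.
Unset Strict Implicit.
Unset Printing Implicit Defensive.

Import Order.TTheory GRing.Theory Num.Theory.
Import numFieldNormedType.Exports.

Local Open Scope classical_set_scope.
Local Open Scope ring_scope.

Record is_star (R : realType) (M : algType R[i]) (star : M -> M) : Prop := {
  starD : forall x y : M, star (x + y) = star x + star y;
  starZ : forall (a : R[i]) (x : M), star (a *: x) = (a^*)%C *: star x;
  starM : forall x y : M, star (x * y) = star y * star x;
  starK : forall x : M, star (star x) = x }.

Definition is_majorana (R : realType) (M : algType R[i]) (star : M -> M)
    (psi : nat -> M) : Prop :=
  (forall i, star (psi i) = psi i) /\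
  (forall i j, psi i * psi j + psi j * psi i = 2 * (i == j)%:R).

Inductive generated (R : realType) (M : algType R[i]) (psi : nat -> M) :
    M -> Prop :=
| generated1 : generated psi 1
| generated_gen i : generated psi (psi i)
| generatedD x y : generated psi x -> generated psi y -> generated psi (x + y)
| generatedM x y : generated psi x -> generated psi y -> generated psi (x * y)
| generatedZ (a : R[i]) x : generated psi x -> generated psi (a *: x).

(* Only the values of [tr] on the algebra generated by [psi] are constrained;
   they are determined by these conditions. *)
Record is_normalized_trace (R : realType) (M : algType R[i]) (psi : nat -> M)
    (tr : M -> R[i]) : Prop := {
  trD : forall x y, generated psi x -> generated psi y ->
    tr (x + y) = tr x + tr y;
  trZ : forall (a : R[i]) x, generated psi x -> tr (a *: x) = a * tr x;
  trC : forall x y, generated psi x -> generated psi y -> tr (x * y) = tr (y * x);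
  tr1 : tr 1 = 1;
  tr_monomial : forall s : seq nat, sorted ltn s -> (0 < size s)%N ->
    tr (\prod_(i <- s) psi i) = 0 }.

Definition mutually_independent (d : measure_display) (T : measurableType d)
    (R : realType) (P : probability T R) (K : choiceType) (D : set K)
    (X : K -> {RV P >-> R}) : Prop :=
  forall F : {fset K}, (forall a, a \in F -> D a) ->
  forall B : K -> set R, (forall a, a \in F -> measurable (B a)) ->
  P (\bigcap_(a in [set a | a \in F]) (X a @^-1` B a)) =
  (\prod_(a <- F) P (X a @^-1` B a))%E.

(* Expectation of a complex random variable; [fine] turns an infinite
   expectation into 0, so this is meaningful for integrable [Z] only. *)
Definition complex_expectation (d : measure_display) (T : measurableType d)
    (R : realType) (P : probability T R) (Z : T -> R[i]) : R[i] :=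
  (fine 'E_P[fun w => complex.Re (Z w)] +i* fine 'E_P[fun w => complex.Im (Z w)])%C.

Definition index_tuple (A : {fset nat}) (r : nat) (s : seq nat) : bool :=
  [&& size s == r, sorted ltn s & all (fun i => i \in A) s].

(* [J s] is the coefficient with index tuple [s], in one realization. *)
Definition syk_hamiltonian (R : realType) (M : algType R[i]) (psi : nat -> M)
    (n : nat) (A : {fset nat}) (r : nat) (J : seq nat -> R) : M :=
  (('i%C : R[i]) ^+ (r %/ 2) / ((Num.sqrt 'C(n, r)%:R)%:C)%C) *:
  \sum_(t : r.-tuple A | sorted ltn [seq val a | a <- t])
     ((J [seq val a | a <- t])%:C)%C *: \prod_(a <- t) psi (val a).

(* The algebraic full Fock space: finite formal linear combinations of words,
   [:: j_1; ...; j_n] standing for e_(j_1) (x) ... (x) e_(j_n) and [::] for the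
   vacuum. *)
Notation fock R I := {freeg (seq I) / R[i]}.

Section Fock.
Context (R : realType) (I : choiceType) (q : I -> I -> R).
Implicit Types (i : I) (u v w : seq I) (x y : fock R I).

Definition tensor w : fock R I := << w >>.

Definition vacuum : fock R I := tensor [::].

(* q_(i, w_1) ... q_(i, w_k) *)
Definition qprefix i w (k : nat) : R := \prod_(j <- take k w) q i j.

Definition delete_at w (k : nat) : seq I := take k w ++ drop k.+1 w.

Fixpoint qform_words u v : R :=
  match u with
  | [::] => (v == [::])%:R
  | i :: u' =>
      \sum_(k < size v) (i == nth i v k)%:R * qprefix i v k
                        * qform_words u' (delete_at v k)
  end.

(* linear in the first argument *)
Definition qform x y : R[i] :=
  \sum_(u <- dom x) \sum_(v <- dom y)
     coeff u x * ((coeff v y)^*)%C * ((qform_words u v)%:C)%C.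

Definition creation i : fock R I -> fock R I :=
  fglift (fun w => tensor (i :: w)).

Definition annihilation i : fock R I -> fock R I :=
  fglift (fun w =>
    \sum_(k < size w)
      ((i == nth i w k)%:R * ((qprefix i w k)%:C)%C) *: tensor (delete_at w k)).

Definition qgaussian i x : fock R I := creation i x + annihilation i x.

Definition vacuum_state (a : fock R I -> fock R I) : R[i] :=
  qform (a vacuum) vacuum.

End Fock.

(* Main.v *)
Require Import Defs.
From mathcomp Require Import all_boot all_order all_algebra finmap.
From mathcomp Require Import all_classical all_reals all_analysis.
From mathcomp Require Import complex freeg.
From mathcomp Require Import measurable_realfun ring lra zify.

(** The expected trace and the moment of the q-Gaussian system are the same sum
over pairings of the letters [k 0], ..., [k l.-1], with a weight for each crossing
of two pairs, and the weights of the first converge to those of the second.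

On the q-Gaussian side a word of operators is applied to the vacuum from right to
left. Each operator creates a letter, which opens a pair, or annihilates an equal
letter, which closes one; annihilation picks up a factor [q] for every open pair
that it crosses. This is the recursion defining [pairing_sum], and
[vacuum_state_pairing_sum] identifies the moment with it.

On the fermionic side, expanding the Hamiltonians gives a sum over words of
labels, a label being a letter together with an index tuple. If a label occurs
only once, the expectation of the product of the couplings vanishes; if all labels
occur exactly twice, it is the product of their variances, one. The remaining
words are too few to contribute in the limit ([moment_pairings], [crowded_sum]).
With its phase every monomial of Majorana fermions has square one, and two
monomials commute up to the sign [exchange_sign]. Hence, when labels are paired,
bringing partners together evaluates the trace to the product of the signs of the
crossings ([word_trace_pairing]). Up to a vanishing error, the expected trace is
therefore a sum over pairings of averages of such products, where each pair carries
an independent uniformly distributed subset ([expectation_near_pairing_avg]).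

It remains to see that the average of a product of exchange signs over the edges
of a finite graph tends to the product of the numbers [q] over its edges
([graph_average]). Vertices are removed one at a time. When all other subsets are
given, the average over the subset at one vertex only depends on the number [x] of
its possible elements that lie in an odd number of the neighbouring subsets; it is
a value of a Krawtchouk-type polynomial, close to [exp (- 2 r x / n)] because
[r = o(n)] and [x = o(n)] ([avg_sign_near_exp]). By a variance estimate the exponent
[r x / n] concentrates around the sum over the neighbours of the mean overlaps, with
an error that is small relative to one plus that sum. This yields the limit
whether the overlaps converge to a finite or to an infinite value
([vertex_average]). *)

Set Implicit Arguments.
Unset Strict Implicit.
Unset Printing Implicit Defensive.

Import Order.TTheory GRing.Theory Num.Theory.
Import numFieldNormedType.Exports.

Local Open Scope classical_set_scope.
Local Open Scope ring_scope.

(** * Subsets of fixed size and elementary symmetric functions *)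

(** Sublists of length [r]; on a strictly increasing list they enumerate the
   index tuples. *)
Fixpoint sublists (s : seq nat) (r : nat) : seq (seq nat) :=
  match s, r with
  | _, 0 => [:: [::]]
  | [::], _.+1 => [::]
  | a :: s', r'.+1 => [seq a :: t | t <- sublists s' r'] ++ sublists s' r'.+1
  end.

Lemma size_sublists s r : size (sublists s r) = 'C(size s, r).
Proof.
elim: s r => [|a s IHs] [|r] //=; rewrite ?bin0 //.
by rewrite size_cat size_map !IHs binS addnC.
Qed.

Lemma mem_sublists s r t :
  (t \in sublists s r) = subseq t s && (size t == r).
Proof.
elim: s r t => [|a s IHs] [|r] [|b t] //=.
- by rewrite inE [RHS]andbF.
- by rewrite mem_cat IHs [size _ == _]/= !andbF orbF; apply/mapP => -[].
rewrite mem_cat IHs /= eqSS.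
have -> : (b :: t \in [seq a :: t0 | t0 <- sublists s r]) =
          (b == a) && (t \in sublists s r).
  apply/mapP/andP => [[u hu [-> ->]]|[/eqP-> ht]]; first by rewrite eqxx.
  by exists t.
rewrite IHs; case: (b =P a) => //= _.
case: (size t == r); rewrite ?andbF ?andbT //.
apply/idP/idP => [/orP[//|]|->//]; exact: cons_subseq.
Qed.

Lemma uniq_sublists s r : uniq s -> uniq (sublists s r).
Proof.
elim: s r => [|a s IHs] [|r] //= /andP[has us].
rewrite cat_uniq !IHs // andbT map_inj_uniq ?IHs //=; last by move=> ? ? [].
apply/hasPn => t; rewrite mem_sublists => /andP[/mem_subseq ts _].
by apply/mapP => -[u _ tu]; move: has; rewrite (ts a) // tu mem_head.
Qed.

Section ElementarySymmetric.
Context (R : comNzRingType).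

Definition elemsym (s : seq nat) (r : nat) (w : nat -> R) : R :=
  \sum_(t <- sublists s r) \prod_(a <- t) w a.

Lemma elemsym0 s w : elemsym s 0 w = 1.
Proof. by rewrite /elemsym; case: s => [|a s] /=; rewrite big_seq1 big_nil. Qed.

Lemma elemsym_nil r w : elemsym [::] r.+1 w = 0.
Proof. by rewrite /elemsym big_nil. Qed.

Lemma elemsym_cons a s r w : elemsym (a :: s) r.+1 w = w a * elemsym s r w + elemsym s r.+1 w.
Proof.
rewrite /elemsym /= big_cat big_map /= mulr_sumr; congr (_ + _).
by apply: eq_bigr => t _; rewrite big_cons.
Qed.

(** Multiplying by the power sum either adds an element to the subset or, the
   weights being signs, removes one. *)
Lemma elemsym_sign_rec s r (w : nat -> R) :
  (forall a, a \in s -> w a ^+ 2 = 1) ->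
  r.+2%:R * elemsym s r.+2 w =
  (\sum_(a <- s) w a) * elemsym s r.+1 w - ((size s)%:R - r%:R) * elemsym s r w.
Proof.
elim: s r => [|a s IHs] r hw.
  rewrite !elemsym_nil big_nil; case: r => [|r]; first by rewrite /= subr0 !(mul0r,mulr0) subr0.
  by rewrite elemsym_nil !mulr0 subr0.
have {}IHs r' : _ := IHs r' (fun b hb => hw b (mem_behead (s := a :: s) hb)).
have ha := hw a (mem_head _ _); rewrite expr2 in ha.
rewrite !elemsym_cons big_cons mulrDr IHs /=.
have hrec : r.+1%:R * elemsym s r.+1 w = (\sum_(a <- s) w a) * elemsym s r w -
    (if r is r'.+1 then ((size s)%:R - r'%:R) * elemsym s r' w else 0).
  case: r => [|r]; last exact: IHs.
  rewrite elemsym0 mul1r mulr1 subr0; clear -R.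
  elim: s => [|b s IHs]; first by rewrite big_nil elemsym_nil.
  by rewrite elemsym_cons elemsym0 mulr1 big_cons IHs.
have -> : r.+2%:R * (w a * elemsym s r.+1 w) =
          w a * (r.+1%:R * elemsym s r.+1 w) + w a * elemsym s r.+1 w.
  by rewrite -[r.+2]addn1 natrD; ring.
rewrite hrec; case: r hrec => [|r] _.
  rewrite !elemsym0 -natr1; ring: ha.
rewrite elemsym_cons -(natr1 (size s)) -(natr1 r); ring: ha.
Qed.

Lemma elemsym1 s (w : nat -> R) : elemsym s 1 w = \sum_(a <- s) w a.
Proof.
elim: s => [|b s IHs]; first by rewrite big_nil elemsym_nil.
by rewrite elemsym_cons elemsym0 mulr1 big_cons IHs.
Qed.

End ElementarySymmetric.

(** * Characters averaged over subsets of fixed size *)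

Section Krawtchouk.
Context (R : realType).

Lemma expRN_quadratic (y : R) : 0 <= y <= 1 ->
  `|expR (- y) - (1 - y)| <= y ^+ 2.
Proof.
move=> /andP[y0 y1]; have := expR_ge1Dx (- y); have := expR_ge1Dx y => h1 h2.
rewrite ger0_norm; last by lra.
have e0 := expR_gt0 y.
rewrite lerBlDr expRN -[leLHS]mul1r ler_pdivrMr //; nra.
Qed.

(** A three-term recurrence whose coefficients are those of an average over
   samples without replacement. The increments stay below [2 * y], so that each
   step is a contraction by [1 - y] up to an error that is [y] times a small
   quantity; the errors therefore do not accumulate. *)
Lemma recurrence_near_exp (a : nat -> R) (n r0 : nat) (y : R) :
  (0 < n)%N -> (4 * r0 <= n)%N -> 0 <= y <= 1 ->
  a 0 = 1 -> a 1 = 1 - y -> (forall r, `|a r| <= 1) ->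
  (forall r, (r.+2 <= r0)%N -> (n%:R - r.+1%:R) * a r.+2 =
     n%:R * (1 - y) * a r.+1 - r.+1%:R * a r) ->
  forall r, (r <= r0)%N -> `|a r - expR (- (r%:R * y))| <= 4 * r0%:R / n%:R + y.
Proof.
move=> n0 r0n hy a0 a1 a_le1 arec; have /andP[y0 y1] := hy.
have n0' : (0 : R) < n%:R by rewrite ltr0n.
have hr0n : 4 * r0%:R <= n%:R :> R by rewrite -natrM ler_nat.
(* The bound reproduces itself as [n + 2 r <= 2 (n - r)], which is [4 r <= n]. *)
have incr r : (r < r0)%N -> `|a r.+1 - a r| <= 2 * y.
  elim: r => [|r IHr] rr0.
    by rewrite a1 a0 addrAC subrr sub0r normrN ger0_norm //; lra.
  have hr : r.+1%:R <= r0%:R :> R by rewrite ler_nat ltnW.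
  have hr' : (0 : R) <= r.+1%:R by rewrite ler0n.
  have pos : 0 < n%:R - r.+1%:R :> R by lra.
  rewrite -(ler_pM2l pos) -{1}[X in X * `|_|]gtr0_norm // -normrM mulrBr arec //.
  have -> : n%:R * (1 - y) * a r.+1 - r.+1%:R * a r - (n%:R - r.+1%:R) * a r.+1 =
            r.+1%:R * (a r.+1 - a r) - n%:R * y * a r.+1 by ring.
  apply: le_trans (ler_normB _ _) _; rewrite !normrM.
  rewrite (ger0_norm hr') (gtr0_norm n0') (ger0_norm y0).
  have := IHr (ltnW rr0); have := a_le1 r.+1 => h1 h2.
  have e1 : r.+1%:R * `|a r.+1 - a r| <= r.+1%:R * (2 * y) by apply: ler_wpM2l.
  have e2 : n%:R * y * `|a r.+1| <= n%:R * y * 1.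
    by apply: ler_wpM2l => //; apply: mulr_ge0 => //; exact: ltW.
  nra.
have step r : (r < r0)%N ->
    `|a r.+1 - (1 - y) * a r| <= y * (4 * r0%:R / n%:R).
  case: r => [|r] rr0.
    by rewrite a1 a0 mulr1 subrr normr0 mulr_ge0.
  have hr : r.+1%:R <= r0%:R :> R by rewrite ler_nat ltnW.
  have hr' : (0 : R) <= r.+1%:R by rewrite ler0n.
  have pos : 0 < n%:R - r.+1%:R :> R by lra.
  rewrite -(ler_pM2l pos) -{1}[X in X * `|_|]gtr0_norm // -normrM mulrBr arec //.
  have -> : n%:R * (1 - y) * a r.+1 - r.+1%:R * a r
            - (n%:R - r.+1%:R) * ((1 - y) * a r.+1) =
            r.+1%:R * ((a r.+1 - a r) - y * a r.+1) by ring.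
  rewrite normrM (ger0_norm hr').
  have h : `|a r.+1 - a r - y * a r.+1| <= 3 * y.
    apply: le_trans (ler_normB _ _) _; rewrite normrM (ger0_norm y0).
    have := incr r (ltnW rr0); have := a_le1 r.+1; nra.
  apply: (@le_trans _ _ (r0%:R * (3 * y))).
    by apply: ler_pM => //; rewrite mulr_ge0 // ltW.
  have -> : (n%:R - r.+1%:R) * (y * (4 * r0%:R / n%:R)) =
            (n%:R - r.+1%:R) * y * 4 * r0%:R / n%:R by ring.
  rewrite ler_pdivlMr //.
  have r00 : (0 : R) <= r0%:R by rewrite ler0n.
  have r0y : (0 : R) <= r0%:R * y by apply: mulr_ge0.
  nra.
elim=> [|r IHr] rr0.
  rewrite a0 mul0r oppr0 expR0 subrr normr0 addr_ge0 //; exact: divr_ge0.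
have {}IHr := IHr (ltnW rr0).
have e0 : expR (- (r%:R * y)) <= 1 by rewrite expR_le1 oppr_le0 mulr_ge0.
have e1 := expR_ge0 (- (r%:R * y)).
have -> : a r.+1 - expR (- (r.+1%:R * y)) =
   (a r.+1 - (1 - y) * a r) + (1 - y) * (a r - expR (- (r%:R * y)))
   - expR (- (r%:R * y)) * (expR (- y) - (1 - y)).
  by rewrite -natr1 mulrDl mul1r opprD expRD; ring.
apply: le_trans (ler_normB _ _) _.
apply: (le_trans (lerD (ler_normD _ _) (lexx _))); rewrite !normrM.
rewrite (ger0_norm e1) (@ger0_norm _ (1 - y)); last by lra.
have h1 := step r rr0; have h2 := expRN_quadratic hy.
set E := 4 * r0%:R / n%:R in h1 IHr *.
have h3 : expR (- (r%:R * y)) * `|expR (- y) - (1 - y)| <= 1 * y ^+ 2.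
  exact: ler_pM.
have h4 : (1 - y) * `|a r - expR (- (r%:R * y))| <= (1 - y) * (E + y).
  by apply: ler_wpM2l => //; lra.
nra.
Qed.

Lemma ler_sum_seq (X : eqType) (s : seq X) (F G : X -> R) :
  {in s, forall x, F x <= G x} -> \sum_(x <- s) F x <= \sum_(x <- s) G x.
Proof.
move=> FG; rewrite big_seq [leRHS]big_seq; apply: ler_sum => x; exact: FG.
Qed.

Definition avg (X : Type) (s : seq X) (F : X -> R) : R :=
  (size s)%:R^-1 * \sum_(x <- s) F x.

Lemma avg_sublists_prod s r (w : nat -> R) :
  avg (sublists s r) (fun t => \prod_(a <- t) w a) = ('C(size s, r))%:R^-1 * elemsym s r w.
Proof. by rewrite /avg size_sublists. Qed.

Section Averages.
Context (X : eqType) (s : seq X).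
Implicit Types F G : X -> R.

Lemma eq_avg F G : {in s, F =1 G} -> avg s F = avg s G.
Proof. by move=> FG; rewrite /avg (eq_big_seq _ FG). Qed.

Lemma avgD F G : avg s (fun x => F x + G x) = avg s F + avg s G.
Proof. by rewrite /avg big_split mulrDr. Qed.

Lemma avgZ c F : avg s (fun x => c * F x) = c * avg s F.
Proof. by rewrite /avg -mulr_sumr mulrCA. Qed.

Lemma ler_avg F G : {in s, forall x, F x <= G x} -> avg s F <= avg s G.
Proof.
by move=> FG; rewrite /avg ler_wpM2l ?invr_ge0 ?ler0n //; exact: ler_sum_seq.
Qed.

Lemma avg_cst c : (0 < size s)%N -> avg s (fun=> c) = c.
Proof.
move=> s0; rewrite /avg big_const_seq count_predT iter_addr_0 -[c *+ _]mulr_natl.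
by rewrite mulrA mulVf ?mul1r // pnatr_eq0 -lt0n.
Qed.

Lemma avg1_le1 : avg s (fun=> 1) <= 1.
Proof.
have [/size0nil s0|s0] := posnP (size s); last by rewrite avg_cst.
by rewrite /avg s0 big_nil mulr0.
Qed.

Lemma avgB F G : avg s (fun x => F x - G x) = avg s F - avg s G.
Proof.
rewrite avgD; congr (_ + _); rewrite -mulN1r -avgZ; apply: eq_avg => x _.
by rewrite mulN1r.
Qed.

Lemma avg_sum (J : Type) (l : seq J) (F : J -> X -> R) :
  avg s (fun x => \sum_(j <- l) F j x) = \sum_(j <- l) avg s (F j).
Proof. by rewrite /avg exchange_big mulr_sumr. Qed.

Lemma ler_norm_avg F : `|avg s F| <= avg s (fun x => `|F x|).
Proof.
by rewrite /avg normrM ger0_norm ?invr_ge0 ?ler0n // ler_wpM2l ?invr_ge0 ?ler0n ?ler_norm_sum.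
Qed.

End Averages.

(** Here [x] is the number of elements with sign [-1]. The elementary symmetric
   functions of the signs, divided by the numbers of subsets, satisfy the recurrence
   above with [y = 2 * x / n]: the sampling is compared with independent draws,
   each of mean sign [1 - y], without any bound on [r ^ 2 / n]. *)
Lemma avg_sign_near_exp (s : seq nat) (r : nat) (w : nat -> R) (x : R) :
  (0 < size s)%N -> (4 * r <= size s)%N ->
  (forall a, a \in s -> w a ^+ 2 = 1) ->
  \sum_(a <- s) w a = (size s)%:R - 2 * x -> 0 <= x -> 2 * x <= (size s)%:R ->
  `|avg (sublists s r) (fun t => \prod_(a <- t) w a)
    - expR (- (2 * (r%:R * x / (size s)%:R)))| <=
  4 * r%:R / (size s)%:R + 2 * x / (size s)%:R.
Proof.
move=> s0 rs hw sumw x0 xs.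
have s0' : (0 : R) < (size s)%:R by rewrite ltr0n.
have sN0 : (size s)%:R != 0 :> R by rewrite gt_eqF.
pose a k := avg (sublists s k) (fun t => \prod_(b <- t) w b).
have -> : 2 * (r%:R * x / (size s)%:R) = r%:R * (2 * x / (size s)%:R) by ring.
apply: (@recurrence_near_exp a) => //; first 1 last.
- by rewrite /a avg_sublists_prod bin0 elemsym0 mulr1 invr1.
- by rewrite /a avg_sublists_prod bin1 elemsym1 sumw; field.
- move=> k; apply: le_trans (ler_norm_avg _ _) _.
  apply: le_trans (ler_avg _) (avg1_le1 (sublists s k)) => t.
  rewrite mem_sublists => /andP[/mem_subseq ts _].
  rewrite normr_prod big1_seq // => b /= bt.
  apply/eqP; rewrite -(@pexpr_eq1 _ _ 2) ?normr_ge0 // -normrX hw ?normr1 //.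
  exact: ts.
- move=> k kr; rewrite /a !avg_sublists_prod.
  have := elemsym_sign_rec k hw; rewrite sumw.
  have kn : (k.+2 <= size s)%N by lia.
  have := mul_bin_left (size s) k; have := mul_bin_left (size s) k.+1.
  move/(congr1 (fun m => m%:R : R)); rewrite !natrM => h1.
  move/(congr1 (fun m => m%:R : R)); rewrite !natrM => h2.
  rewrite (natrB _ (ltnW kn)) in h1; rewrite (natrB _ (ltnW (ltnW kn))) in h2.
  have b j : (j <= k.+2)%N -> ('C(size s, j))%:R != 0 :> R.
    by move=> jk; rewrite pnatr_eq0 -lt0n bin_gt0; lia.
  move=> h3.
  have p2 := b k.+2 (leqnn _); have p1 := b k.+1 (leqnSn _).
  have p0 := b k (leq_trans (leqnSn _) (leqnSn _)).
  have e2 : (size s)%:R - k.+1%:R = k.+2%:R * ('C(size s, k.+2))%:R / ('C(size s, k.+1))%:R :> R.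
    by rewrite h1 mulfK.
  have e1 : k.+1%:R = ((size s)%:R - k%:R) * ('C(size s, k))%:R / ('C(size s, k.+1))%:R :> R.
    by rewrite -h2 mulfK.
  rewrite e2 e1.
  transitivity (('C(size s, k.+1))%:R^-1 * (k.+2%:R * elemsym s k.+2 w)).
    by field; rewrite p1 p2.
  by rewrite h3; field; rewrite p0 p1 sN0.
- by rewrite divr_ge0 ?mulr_ge0 //= ler_pdivrMr // mul1r.
Qed.

End Krawtchouk.

(** * Intersections with a random subset *)

Section RandomSubset.
Context (R : realType).
Implicit Types (s l t : seq nat) (r : nat).

Lemma elemsym_indicator s r (P : pred nat) :
  elemsym s r (fun a => (P a)%:R : R) = ('C(count P s, r))%:R.
Proof.
elim: s r => [|a s IHs] [|r]; rewrite ?elemsym0 ?bin0 ?elemsym_nil //.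
rewrite elemsym_cons !IHs /=; case: (P a); rewrite ?mul0r ?add0r ?mul1r //.
by rewrite binS natrD addrC.
Qed.

Lemma prod_notin (l t : seq nat) :
  \prod_(a <- t) (a \notin l)%:R = (all (fun a => a \notin t) l)%:R :> R.
Proof.
rewrite -[RHS]/(nat_of_bool _)%:R.
have -> : all (fun a => a \notin t) l = all (fun a => a \notin l) t.
  by apply/allP/allP => h a ha; apply/negP => hb; have := h _ hb; rewrite ha.
elim: t => [|a t IHt]; first by rewrite big_nil.
by rewrite big_cons IHt -natrM mulnb.
Qed.

Section Fixed.
Context (s : seq nat) (r : nat) (us : uniq s) (rs : (r <= size s)%N)
  (s0 : (0 < size s)%N).

Let sN0 : (size s)%:R != 0 :> R. Proof. by rewrite pnatr_eq0 -lt0n. Qed.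

Lemma size_sublists_gt0 : (0 < size (sublists s r))%N.
Proof. by rewrite size_sublists bin_gt0. Qed.

Lemma avg_notin a : a \in s ->
  avg (sublists s r) (fun t => (a \notin t)%:R : R) = 1 - r%:R / (size s)%:R.
Proof.
move=> ha; under eq_avg => t _ do rewrite -[a \notin t]andbT -(prod_notin [:: a]).
rewrite avg_sublists_prod elemsym_indicator.
have -> : count (fun b => b \notin [:: a]) s = (size s).-1.
  have := count_predC (pred1 a) s; rewrite (count_uniq_mem _ us) ha => <-.
  by rewrite add1n /=; apply: eq_count => b /=; rewrite inE.
have := mul_bin_down (size s) r; move/(congr1 (fun m => m%:R : R)).
rewrite !natrM natrB // => h.
have b0 : ('C(size s, r))%:R != 0 :> R by rewrite pnatr_eq0 -lt0n bin_gt0.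
have -> : ('C((size s).-1, r))%:R = ((size s)%:R - r%:R) * ('C(size s, r))%:R / (size s)%:R :> R.
  by rewrite -h mulrC mulKf.
by field; rewrite sN0 b0.
Qed.

Lemma avg_mem a :
  avg (sublists s r) (fun t => (a \in t)%:R : R) = (a \in s)%:R * (r%:R / (size s)%:R).
Proof.
have [ha|ha] := boolP (a \in s); last first.
  rewrite mul0r -(mul0r (avg (sublists s r) (fun=> 0 : R))) -avgZ; apply: eq_avg => t.
  rewrite mem_sublists mul0r => /andP[/mem_subseq ts _].
  by case: (boolP (a \in t)) => // /ts; rewrite (negbTE ha).
rewrite mul1r; have := avg_notin ha.
have -> : avg (sublists s r) (fun t => (a \notin t)%:R : R) =
    avg (sublists s r) (fun t => 1 - (a \in t)%:R : R).
  by apply: eq_avg => t _; case: (a \in t); rewrite ?subrr ?subr0.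
by rewrite avgB avg_cst ?size_sublists_gt0 // => h; lra.
Qed.

(** Sampling without replacement makes the events [a \notin t] negatively
   correlated. *)
Lemma avg_notin2 a b : a \in s -> b \in s -> a != b ->
  avg (sublists s r) (fun t => (a \notin t)%:R * (b \notin t)%:R : R) <=
  (1 - r%:R / (size s)%:R) ^+ 2.
Proof.
move=> ha hb ab.
under eq_avg => t _ do
  rewrite -natrM mulnb -[b \notin t]andbT -(prod_notin [:: a; b]).
rewrite avg_sublists_prod elemsym_indicator.
have -> : count (fun c => c \notin [:: a; b]) s = (size s).-2.
  have := count_predC (mem [:: a; b]) s.
  have -> : count (mem [:: a; b]) s = 2.
    have := count_predUI (pred1 a) (pred1 b) s.
    rewrite !(count_uniq_mem _ us) ha hb.
    have -> : count (predI (pred1 a) (pred1 b)) s = 0%N.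
      rewrite -(count_pred0 s); apply: eq_count => c /=.
      by case: eqP => // ->; rewrite (negbTE ab).
    rewrite addn0 => h; rewrite -[RHS]h.
    by apply: eq_count => c /=; rewrite !inE.
  by move=> <-.
have s2 : (1 < size s)%N.
  by apply: (@leq_trans (size [:: a; b])) => //; apply: uniq_leq_size => [|c];
    rewrite /= ?inE ?ab // => /orP[] /eqP->.
have := mul_bin_down (size s) r; have := mul_bin_down (size s).-1 r.
move: (size s) rs s2 sN0 => [//|[//|n]] /= rn _ nN0 h1 h2.
have c1 : (n.+2)%:R * ('C(n.+1, r))%:R = (n.+2%:R - r%:R) * ('C(n.+2, r))%:R :> R.
  by rewrite -natrM h2 natrM natrB.
have c2 : (n.+1)%:R * ('C(n, r))%:R <= (n.+2%:R - r%:R) * (n.+1%:R / n.+2%:R) * ('C(n.+1, r))%:R :> R.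
  rewrite -natrM h1 natrM; apply: ler_wpM2r; rewrite ?ler0n //.
  have [rn'|rn'] := leqP r n.+1; last first.
    have -> : (n.+1 - r)%N = 0%N by lia.
    by rewrite mulr_ge0 // subr_ge0 ler_nat.
  rewrite natrB // mulrA ler_pdivlMr ?ltr0n // -(natr1 n.+1).
  have : 0 <= r%:R :> R by rewrite ler0n.
  by move=> ?; nra.
have b0 : (0 : R) < ('C(n.+2, r))%:R by rewrite ltr0n bin_gt0.
have n1 : (0 : R) < n.+1%:R by rewrite ltr0n.
have n2 : (0 : R) < n.+2%:R by rewrite ltr0n.
have e1 : ('C(n.+1, r))%:R = (1 - r%:R / n.+2%:R) * ('C(n.+2, r))%:R :> R.
  apply: (mulfI (lt0r_neq0 n2)); rewrite c1; field; exact: lt0r_neq0.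
rewrite mulrC ler_pdivrMr // -(ler_pM2l n1); apply: le_trans c2 _.
rewrite e1 le_eqVlt; apply/orP; left; apply/eqP; field; exact: lt0r_neq0.
Qed.

(** The variance is at most that of independent trials with success probability
   [p = r / n]; it is computed with the complementary events, whose pair
   probabilities are the ones bounded above. *)
Lemma avg_count_variance l : uniq l -> {subset l <= s} ->
  avg (sublists s r) (fun t => (\sum_(a <- l) (a \in t)%:R
     - (size l)%:R * (r%:R / (size s)%:R)) ^+ 2 : R) <=
  (size l)%:R * (r%:R / (size s)%:R).
Proof.
move=> ul ls; set p : R := r%:R / (size s)%:R.
have p0 : 0 <= p by exact: divr_ge0.
have p1 : p <= 1 by rewrite ler_pdivrMr ?ltr0n // mul1r ler_nat.
pose y (a : nat) (t : seq nat) : R := (a \notin t)%:R.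
have sumcst (c : R) : \sum_(a <- l) c = (size l)%:R * c.
  by rewrite big_const_seq count_predT iter_addr_0 mulr_natl.
have ey a : a \in l -> avg (sublists s r) (y a) = 1 - p.
  by move=> al; rewrite avg_notin // ls.
have eyy a b : a \in l -> b \in l ->
    avg (sublists s r) (fun t => y a t * y b t) <=
    (1 - p) ^+ 2 + (a == b)%:R * ((1 - p) * p).
  move=> al bl; have [<-|ab] := eqVneq a b.
    rewrite (_ : avg _ _ = 1 - p); first by rewrite mul1r; lra.
    rewrite -(ey _ al); apply: eq_avg => t _.
    by rewrite /y -natrM mulnb andbb.
  by rewrite mul0r addr0 avg_notin2 ?ls.
set m : R := (size l)%:R.
have m0 : 0 <= m by exact: ler0n.
have -> : avg (sublists s r) (fun t => (\sum_(a <- l) (a \in t)%:R - m * p) ^+ 2) =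
    avg (sublists s r) (fun t => \sum_(a <- l) \sum_(b <- l) y a t * y b t)
    - 2 * (m * (1 - p)) * avg (sublists s r) (fun t => \sum_(a <- l) y a t)
    + (m * (1 - p)) ^+ 2 * avg (sublists s r) (fun=> 1).
  rewrite -!avgZ -avgB -avgD; apply: eq_avg => t _.
  have -> : \sum_(a <- l) \sum_(b <- l) y a t * y b t = (\sum_(a <- l) y a t) ^+ 2.
    by rewrite expr2 mulr_suml; apply: eq_bigr => a _; rewrite mulr_sumr.
  have -> : \sum_(a <- l) (a \in t)%:R = m - \sum_(a <- l) y a t.
    rewrite -[m]mulr1 -sumcst -sumrB; apply: eq_bigr => a _; rewrite /y.
    by case: (a \in t); rewrite ?subrr ?subr0.
  by ring.
rewrite avg_cst ?size_sublists_gt0 // !avg_sum.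
rewrite (_ : \sum_(a <- l) avg (sublists s r) (y a) = m * (1 - p)); last first.
  by rewrite -sumcst; apply: eq_big_seq => a; exact: ey.
apply: (@le_trans _ _ (m * p * (1 - p))); last first.
  by rewrite ler_piMr ?mulr_ge0 //; lra.
have : \sum_(a <- l) avg (sublists s r) (fun t => \sum_(b <- l) y a t * y b t) <=
   \sum_(a <- l) (m * (1 - p) ^+ 2 + (1 - p) * p).
  apply: ler_sum_seq => a al; rewrite avg_sum.
  apply: le_trans (ler_sum_seq (fun b bl => eyy a b al bl)) _.
  rewrite big_split /= sumcst lerD2l -mulr_suml.
  rewrite -[leRHS]mul1r ler_wpM2r ?mulr_ge0 ?subr_ge0 //.
  have -> : \sum_(b <- l) (a == b)%:R = (count_mem a l)%:R :> R.
    rewrite -sum1_count natr_sum [RHS]big_mkcond /=; apply: eq_bigr => b _.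
    by rewrite eq_sym; case: (b == a).
  by rewrite (count_uniq_mem _ ul) al.
rewrite sumcst; lra.
Qed.

(** From [2 * `|D| <= D ^+ 2 / c + c]; the parameter [c] is free so that it can be
   adapted to the scale on which the deviation is measured. *)
Lemma avg_count_deviation l (c : R) : uniq l -> {subset l <= s} -> 0 < c ->
  avg (sublists s r) (fun t => `|\sum_(a <- l) (a \in t)%:R
     - (size l)%:R * (r%:R / (size s)%:R)|) <=
  ((size l)%:R * (r%:R / (size s)%:R) / c + c) / 2.
Proof.
move=> ul ls c0; have := avg_count_variance ul ls.
set V := (size l)%:R * (r%:R / (size s)%:R).
pose D (t : seq nat) : R := \sum_(a <- l) (a \in t)%:R - V.
rewrite -[avg _ _]/(avg _ (fun t => D t ^+ 2)) => hV.
rewrite -[avg _ _]/(avg _ (fun t => `|D t|)).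
apply: (@le_trans _ _ (avg (sublists s r) (fun t => (2 * c)^-1 * D t ^+ 2 + c / 2 * 1))).
  apply: ler_avg => t _; rewrite mulr1.
  have : 0 <= (`|D t| - c) ^+ 2 by exact: sqr_ge0.
  rewrite sqrrB real_normK ?num_real // => h.
  rewrite mulrC -{2}[c](@mulfK _ (2 * c)) ?lt0r_neq0 ?mulr_gt0 //.
  have -> : D t ^+ 2 / (2 * c) + c * (2 * c) / (2 * c) / 2 = (D t ^+ 2 + c ^+ 2) / (2 * c).
    by field; rewrite lt0r_neq0.
  by rewrite ler_pdivlMr ?mulr_gt0 //; lra.
rewrite avgD !avgZ avg_cst ?size_sublists_gt0 // mulr1 (mulrDl _ _ (2^-1)) lerD2r.
have -> : V / c / 2 = (2 * c)^-1 * V by field; rewrite lt0r_neq0.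
by rewrite ler_wpM2l // invr_ge0 mulr_ge0 // ltW.
Qed.

End Fixed.
End RandomSubset.

(** * Independent families of random subsets *)

Section Configurations.
Context (R : realType) (L : nat -> seq (seq nat)).
Implicit Types (p : nat) (f : nat -> seq nat) (F G : (nat -> seq nat) -> R).

(** Expectation of [F f] when the sets [f 0], ..., [f p.-1] are independent and
   [f j] is uniform in [L j]. *)
Fixpoint cavg p F : R :=
  if p is p'.+1
  then cavg p' (fun f => avg (L p') (fun t => F [eta f with p' |-> t]))
  else F (fun=> [::]).

Definition chosen p f := forall j, (j < p)%N -> f j \in L j.

Lemma chosenS p f t : chosen p f -> t \in L p -> chosen p.+1 [eta f with p |-> t].
Proof.
move=> hf ht j; rewrite ltnS leq_eqVlt /= => /orP[/eqP->|jp]; first by rewrite eqxx.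
by rewrite ltn_eqF //; exact: hf.
Qed.

Lemma ler_cavg p F G : (forall f, chosen p f -> F f <= G f) -> cavg p F <= cavg p G.
Proof.
elim: p F G => [|p IHp] F G FG /=; first by apply: FG.
by apply: IHp => f hf; apply: ler_avg => t ht; apply: FG; exact: chosenS.
Qed.

Lemma eq_cavg p F G : (forall f, chosen p f -> F f = G f) -> cavg p F = cavg p G.
Proof.
by move=> FG; apply/le_anti/andP; split; apply: ler_cavg => f hf; rewrite FG.
Qed.

Lemma cavgD p F G : cavg p (fun f => F f + G f) = cavg p F + cavg p G.
Proof.
elim: p F G => [|p IHp] F G //=; rewrite -IHp.
by apply: eq_cavg => f _; rewrite avgD.
Qed.

Lemma cavgZ p c F : cavg p (fun f => c * F f) = c * cavg p F.
Proof.
elim: p F => [|p IHp] F //=; rewrite -IHp.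
by apply: eq_cavg => f _; rewrite avgZ.
Qed.

Lemma cavgB p F G : cavg p (fun f => F f - G f) = cavg p F - cavg p G.
Proof.
rewrite cavgD; congr (_ + _); rewrite -mulN1r -cavgZ; apply: eq_cavg => f _.
by rewrite mulN1r.
Qed.

Lemma cavg_sum p (J : Type) (l : seq J) (F : J -> (nat -> seq nat) -> R) :
  cavg p (fun f => \sum_(j <- l) F j f) = \sum_(j <- l) cavg p (F j).
Proof.
elim: l => [|j l IHl].
  rewrite big_nil -[RHS](mul0r (cavg p (fun=> 0))) -cavgZ.
  by apply: eq_cavg => f _; rewrite big_nil mul0r.
by rewrite big_cons -IHl -cavgD; apply: eq_cavg => f _; rewrite big_cons.
Qed.

Lemma ler_norm_cavg p F : `|cavg p F| <= cavg p (fun f => `|F f|).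
Proof.
rewrite ler_norml -mulN1r -cavgZ; apply/andP; split; apply: ler_cavg => f _.
  by rewrite mulN1r lerNl -normrN ler_norm.
exact: ler_norm.
Qed.

Context (L_gt0 : forall j, (0 < size (L j))%N).

Lemma cavg_cst p c : cavg p (fun=> c) = c.
Proof.
elim: p => //= p IHp; rewrite -[RHS]IHp; apply: eq_cavg => f _; exact: avg_cst.
Qed.

Lemma cavg_marginal p j (g : seq nat -> R) : (j < p)%N ->
  cavg p (fun f => g (f j)) = avg (L j) g.
Proof.
elim: p => // p IHp; rewrite ltnS leq_eqVlt /= => /orP[/eqP->|jp].
  by under eq_cavg => f _ do under eq_avg => t _ do rewrite eqxx; rewrite cavg_cst.
rewrite -(IHp jp); apply: eq_cavg => f _; rewrite ltn_eqF //; exact: avg_cst.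
Qed.

Lemma cavg_independent p j k (g h : seq nat -> R) : (j < p)%N -> (k < p)%N ->
  j != k ->
  cavg p (fun f => g (f j) * h (f k)) = avg (L j) g * avg (L k) h.
Proof.
wlog jk : j k g h / (j < k)%N => [hw|] jp kp.
  rewrite neq_ltn => /orP[jk|kj]; first by rewrite hw // neq_ltn jk.
  rewrite [RHS]mulrC -(hw k j h g kj kp jp) ?neq_ltn ?kj //.
  by apply: eq_cavg => f _; rewrite mulrC.
move=> _; elim: p kp jp => // p IHp; rewrite ltnS leq_eqVlt /= => /orP[/eqP kp|kp] _.
  subst p; rewrite -(cavg_marginal g jk) mulrC -cavgZ; apply: eq_cavg => f _.
  by rewrite eqxx (ltn_eqF jk) avgZ mulrC.
rewrite -(IHp kp (ltn_trans jk kp)); apply: eq_cavg => f _.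
by rewrite (ltn_eqF kp) (ltn_eqF (ltn_trans jk kp)) avg_cst.
Qed.

End Configurations.

(** * Averaging out one subset against the others *)

Section Vertex.
Context (R : realType).

(** Exponentials of nonnegative exponents are close relative to the size of the
   exponents: this treats bounded and diverging exponents alike. *)
Lemma expRN2_lipschitz (x y : R) : 0 <= x -> 0 <= y ->
  (1 + y) * `|expR (- (2 * x)) - expR (- (2 * y))| <= 4 * `|x - y|.
Proof.
move=> x0 y0.
have lip (a b : R) : a <= b ->
    `|expR (- (2 * a)) - expR (- (2 * b))| <= expR (- (2 * a)) * (2 * `|a - b|).
  move=> ab; rewrite ger0_norm; last by rewrite subr_ge0 ler_expR lerN2 ler_pM2l.
  rewrite (distrC a) ger0_norm ?subr_ge0 //.
  have -> : expR (- (2 * b)) = expR (- (2 * a)) * expR (- (2 * (b - a))).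
    by rewrite -expRD; congr expR; ring.
  rewrite -[X in X - _]mulr1 -mulrBr ler_wpM2l ?expR_ge0 //.
  have := expR_ge1Dx (- (2 * (b - a))); lra.
have e_le (a : R) : 0 <= a -> (1 + 2 * a) * expR (- (2 * a)) <= 1.
  move=> a0; rewrite expRN ler_pdivrMr ?expR_gt0 // mul1r.
  exact: expR_ge1Dx.
have [xy|yx] := leP y x.
  have := lip _ _ xy; rewrite distrC (distrC y).
  set d := `|expR _ - _|; have := e_le _ y0; have := expR_ge0 (- (2 * y)).
  have : 0 <= `|x - y| by []. set E := expR _; set D := `|x - y| => D0 E0 hE hd.
  have yE : 0 <= y * E by apply: mulr_ge0.
  have : (1 + y) * d <= (1 + y) * (E * (2 * D)) by apply: ler_wpM2l => //; lra.
  have : ((1 + y) * E) * (2 * D) <= 1 * (2 * D) by apply: ler_wpM2r => //; lra.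
  lra.
have := lip _ _ (ltW yx); set d := `|expR _ - _|.
have d1 : d <= 1.
  rewrite /d ger0_norm; last by rewrite subr_ge0 ler_expR lerN2 ler_pM2l // ltW.
  have := expR_ge0 (- (2 * y)).
  have : expR (- (2 * x)) <= 1 by rewrite expR_le1 oppr_le0 mulr_ge0.
  lra.
have := e_le _ x0; have := expR_ge0 (- (2 * x)).
have d0 : 0 <= d by exact: normr_ge0.
rewrite distrC gtr0_norm ?subr_gt0 //; set E := expR _ => E0 hE hd.
have : E * (2 * (y - x)) * x <= y - x.
  have : (1 + 2 * x) * E * (y - x) <= 1 * (y - x) by apply: ler_wpM2r => //; lra.
  have : 0 <= E * (y - x) by apply: mulr_ge0 => //; lra.
  lra.
have : E * (2 * (y - x)) <= 2 * (y - x).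
  rewrite -[leRHS]mul1r; apply: ler_wpM2r; first by lra.
  have : 0 <= x * E by apply: mulr_ge0.
  lra.
have : d * x <= E * (2 * (y - x)) * x by apply: ler_wpM2r.
have : d * (y - x) <= 1 * (y - x) by apply: ler_wpM2r => //; lra.
lra.
Qed.

Lemma prod_sign_count (bs : seq nat) (m : nat -> bool) :
  \prod_(b <- bs) (-1) ^+ m b = (-1) ^+ count m bs :> R.
Proof.
elim: bs => [|b bs IHbs]; first by rewrite big_nil.
by rewrite big_cons IHbs exprD.
Qed.

(** With [m] true bits the right-hand side is [m * (m - 1)]: it vanishes when the
   parity equals [m], that is for [m <= 1], and otherwise it is at least [m]. *)
Lemma parity_count_le (bs : seq nat) (m : nat -> bool) : uniq bs ->
  `|(1 - \prod_(b <- bs) (-1) ^+ m b) / 2 - \sum_(b <- bs) (m b)%:R| <=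
  \sum_(b <- bs) \sum_(c <- bs | b != c) (m b)%:R * (m c)%:R :> R.
Proof.
move=> ubs; set M := \sum_(b <- bs) (m b)%:R.
have -> : \sum_(b <- bs) \sum_(c <- bs | b != c) (m b)%:R * (m c)%:R = M ^+ 2 - M.
  apply/eqP; rewrite eq_sym subr_eq; apply/eqP.
  rewrite expr2 mulr_suml -big_split /=; apply: eq_big_seq => b hb.
  rewrite mulr_sumr (bigD1_seq b) //= -natrM mulnb andbb addrC; congr (_ + _).
  by apply: eq_bigl => c; rewrite eq_sym.
rewrite prod_sign_count; have -> : M = (count m bs)%:R.
  rewrite -sum1_count natr_sum [RHS]big_mkcond /=; apply: eq_bigr => b _.
  by case: (m b).
case: (count m bs) => [|[|k]].
- by rewrite expr0 subrr mul0r subrr normr0.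
- have -> : (1 - (-1) ^+ 1) / 2 = 1 :> R by rewrite expr1; field.
  by rewrite expr1n subrr normr0.
rewrite -signr_odd.
have : 2 <= k.+2%:R :> R by rewrite ler_nat.
set u := k.+2%:R => u2.
have : (1 - (-1) ^+ odd k.+2) / 2 = (odd k.+2)%:R :> R.
  by case: (odd _) => /=; [rewrite expr1; field|rewrite expr0 subrr mul0r].
move=> ->; have : (odd k.+2)%:R <= 1 :> R by rewrite lern1 leq_b1.
have : 0 <= (odd k.+2)%:R :> R by rewrite ler0n.
have : 2 * u <= u ^+ 2 by rewrite expr2; apply: ler_wpM2r => //; lra.
by move=> h0 h1 h2; rewrite ler_norml; apply/andP; split; lra.
Qed.

Definition parity_sign (t t' : seq nat) : R := \prod_(a <- t) (-1) ^+ (a \in t').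

Context (n p : nat) (s_ : nat -> seq nat) (r_ : nat -> nat)
  (n_gt0 : (0 < n)%N) (s_uniq : forall b, uniq (s_ b))
  (s_size : forall b, size (s_ b) = n) (r_le : forall b, (r_ b <= n)%N).
Let L b := sublists (s_ b) (r_ b).

Let L_gt0 b : (0 < size (L b))%N.
Proof. by apply: size_sublists_gt0; rewrite s_size. Qed.

(** Given the other sets, the average over one of them depends only on the
   number of its possible elements lying in an odd number of the others; that
   number concentrates around its mean, the overlaps of the others being
   negligible compared with the mean. *)
Lemma vertex_average (s : seq nat) (r : nat) (bs : seq nat) :
  uniq s -> size s = n -> (0 < r)%N -> (4 * r <= n)%N ->
  uniq bs -> (forall b, b \in bs -> (b < p)%N) ->
  (2 * \sum_(b <- bs) r_ b <= n)%N ->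
  forall d e : R, d = r%:R / n%:R -> e = \sum_(b <- bs) (r_ b)%:R / n%:R ->
  cavg L p (fun f => `|avg (sublists s r) (fun t => \prod_(b <- bs) parity_sign t (f b))
     - expR (- (2 * \sum_(b <- bs)
         r%:R * (r_ b)%:R / n%:R * ((count (mem (s_ b)) s)%:R / n%:R)))|) <=
  4 * d + 2 * e + 4 * ((size bs)%:R * Num.sqrt d + e).
Proof.
move=> us sn r0 rn ubs bsp rbs d e dE eE.
have n0 : (0 : R) < n%:R by rewrite ltr0n.
have nN0 : n%:R != 0 :> R by rewrite lt0r_neq0.
have d0 : 0 < d by rewrite dE divr_gt0 ?ltr0n.
pose rb b : R := (r_ b)%:R / n%:R.
have rb0 b : 0 <= rb b by exact: divr_ge0.
have rb1 b : rb b <= 1 by rewrite ler_pdivrMr // mul1r ler_nat.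
have e0 : 0 <= e by rewrite eE; apply: sumr_ge0 => b _; exact: rb0.
pose mb b : R := (count (mem (s_ b)) s)%:R.
pose lam b : R := d * (mb b * rb b).
have lam0 b : 0 <= lam b by rewrite mulr_ge0 ?(ltW d0) ?mulr_ge0 ?rb0 ?ler0n.
have -> : \sum_(b <- bs) r%:R * (r_ b)%:R / n%:R * ((count (mem (s_ b)) s)%:R / n%:R)
    = \sum_(b <- bs) lam b.
  by apply: eq_bigr => b _; rewrite /lam dE /rb /mb; field.
set Lam := \sum_(b <- bs) lam b.
have Lam0 : 0 <= Lam by apply: sumr_ge0.
have lamLam b : b \in bs -> lam b <= Lam.
  by move=> hb; rewrite /Lam (bigD1_seq b) //= lerDl; apply: sumr_ge0.
pose D (f : nat -> seq nat) (b : nat) : R := \sum_(a <- s) (a \in f b)%:R.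
pose ov (f : nat -> seq nat) : R :=
  \sum_(a <- s) \sum_(b <- bs) \sum_(c <- bs | b != c)
    (a \in f b)%:R * (a \in f c)%:R.
have pointwise f : chosen L p f ->
    `|avg (sublists s r) (fun t => \prod_(b <- bs) parity_sign t (f b)) - expR (- (2 * Lam))|
    <= 4 * d + 2 * e + 4 / (1 + Lam) *
       (\sum_(b <- bs) `|d * D f b - lam b| + d * ov f).
  move=> hf; pose w a : R := \prod_(b <- bs) (-1) ^+ (a \in f b).
  pose x : R := \sum_(a <- s) (1 - w a) / 2.
  have w_sign a : w a = (-1) ^+ count (fun b => a \in f b) bs by exact: prod_sign_count.
  have wle a : 0 <= (1 - w a) / 2.
    by rewrite w_sign -signr_odd; case: (odd _); rewrite ?expr0 ?expr1; lra.
  have x0 : 0 <= x by apply: sumr_ge0 => a _; exact: wle.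
  have -> : avg (sublists s r) (fun t => \prod_(b <- bs) parity_sign t (f b)) =
      avg (sublists s r) (fun t => \prod_(a <- t) w a).
    by apply: eq_avg => t _; rewrite exchange_big.
  have sumw : \sum_(a <- s) w a = (size s)%:R - 2 * x.
    rewrite /x mulr_sumr -(sum1_size s) natr_sum -sumrB.
    by apply: eq_bigr => a _; field.
  have xD : x <= \sum_(b <- bs) D f b.
    rewrite /x /D exchange_big /=; apply: ler_sum => a _.
    have -> : \sum_(b <- bs) (a \in f b)%:R = (count (fun b => a \in f b) bs)%:R :> R.
      rewrite -sum1_count natr_sum [RHS]big_mkcond /=; apply: eq_bigr => b _.
      by case: (a \in f b).
    rewrite w_sign; case: (count _ _) => [|k]; first by rewrite expr0 subrr mul0r.
    apply: (@le_trans _ _ 1); last by rewrite ler1n.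
    by rewrite -signr_odd; case: (odd _); rewrite ?expr0 ?expr1; lra.
  have Dr b : b \in bs -> D f b <= (r_ b)%:R.
    move=> hb; have := hf b (bsp b hb); rewrite mem_sublists => /andP[_ /eqP <-].
    rewrite /D -natr_sum ler_nat.
    have -> : (\sum_(a <- s) (a \in f b) = size [seq a <- s | a \in f b])%N.
      rewrite size_filter -sum1_count [RHS]big_mkcond /=.
      by apply: eq_bigr => a _; case: (a \in f b).
    apply: uniq_leq_size; first exact: filter_uniq.
    by move=> a; rewrite mem_filter => /andP[].
  have xe : x <= n%:R * e.
    apply: le_trans xD _; rewrite eE mulr_sumr; apply: ler_sum_seq => b hb.
    by rewrite mulrCA divff // mulr1 Dr.
  have e2 : 2 * (n%:R * e) <= n%:R.
    rewrite eE mulr_sumr (eq_bigr (fun b => (r_ b)%:R)); last first.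
      by move=> b _; rewrite mulrCA divff // mulr1.
    by rewrite -natr_sum -natrM ler_nat.
  have x2 : 2 * x <= (size s)%:R.
    by rewrite sn; apply: le_trans e2; rewrite ler_pM2l.
  have s0 : (0 < size s)%N by rewrite sn.
  have rs : (4 * r <= size s)%N by rewrite sn.
  have wsq a : a \in s -> w a ^+ 2 = 1 by move=> _; rewrite w_sign sqrr_sign.
  have := avg_sign_near_exp s0 rs wsq sumw x0 x2; rewrite sn.
  set K := avg _ _; have -> : r%:R * x / n%:R = d * x by rewrite dE; ring.
  set X := d * x; have X0 : 0 <= X by apply: mulr_ge0 => //; exact: ltW.
  move=> hK; have hE := expRN2_lipschitz X0 Lam0.
  have hXL : `|X - Lam| <= \sum_(b <- bs) `|d * D f b - lam b| + d * ov f.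
    have -> : X - Lam = \sum_(b <- bs) (d * D f b - lam b)
        + d * (x - \sum_(b <- bs) D f b).
      by rewrite sumrB -(mulr_sumr bs) [in RHS]mulrBr -/Lam -/X; ring.
    apply: le_trans (ler_normD _ _) _; apply: lerD; first exact: ler_norm_sum.
    rewrite normrM (gtr0_norm d0) ler_pM2l // /x /D exchange_big -sumrB.
    apply: le_trans (ler_norm_sum _ _ _) _; apply: ler_sum => a _.
    exact: parity_count_le.
  have L1 : 0 < 1 + Lam by lra.
  rewrite [leLHS](_ : _ = `|(K - expR (- (2 * X))) + (expR (- (2 * X)) - expR (- (2 * Lam)))|);
    last by congr `|_|; ring.
  apply: le_trans (ler_normD _ _) _; apply: lerD.
    apply: le_trans hK _; rewrite -(mulrA 4 r%:R) -dE lerD2l -mulrA.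
    by rewrite ler_pM2l // ler_pdivrMr // mulrC.
  rewrite mulrAC ler_pdivlMr // mulrC; apply: le_trans hE _.
  by rewrite ler_pM2l.
apply: le_trans (ler_cavg pointwise) _.
rewrite cavgD cavg_cst // lerD2l cavgZ cavgD cavgZ cavg_sum.
have L1 : 0 < 1 + Lam by lra.
rewrite mulrAC ler_pdivrMr // -mulrA ler_pM2l // mulrDl lerD //.
- rewrite -sum1_size natr_sum !mulr_suml; apply: ler_sum_seq => b hb.
  rewrite mul1r; apply: (@le_trans _ _ (Num.sqrt d * (1 + lam b))); last first.
    by rewrite ler_wpM2l ?sqrtr_ge0 // lerD2l lamLam.
  pose l := [seq a <- s | a \in s_ b].
  have ul : uniq l by exact: filter_uniq.
  have ls : {subset l <= s_ b} by move=> a; rewrite mem_filter => /andP[].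
  have rsb : (r_ b <= size (s_ b))%N by rewrite s_size.
  have sb0 : (0 < size (s_ b))%N by rewrite s_size.
  have lam1 : 0 < 1 + lam b by rewrite ltr_wpDr.
  have sd0 : 0 < Num.sqrt d by rewrite sqrtr_gt0.
  have sdd : Num.sqrt d * Num.sqrt d = d by rewrite -expr2 sqr_sqrtr // ltW.
  (* This choice balances the two terms of the deviation bound. *)
  have c0 : 0 < (1 + lam b) / Num.sqrt d by exact: divr_gt0.
  have := avg_count_deviation (s_uniq b) rsb sb0 ul ls c0.
  rewrite s_size; have -> : (size l)%:R = mb b :> R by rewrite size_filter.
  rewrite -/(rb b) => hdev.
  rewrite (_ : cavg _ _ _ = d * avg (L b) (fun t => `|\sum_(a <- l) (a \in t)%:R - mb b * rb b|)).
    apply: le_trans (ler_wpM2l (ltW d0) hdev) _.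
    have -> : d * ((mb b * rb b / ((1 + lam b) / Num.sqrt d) + (1 + lam b) / Num.sqrt d) / 2)
       = (lam b / (1 + lam b) + (1 + lam b)) * Num.sqrt d / 2.
      have scaling (m u v : R) : u != 0 -> v != 0 ->
          v * v * ((m / (u / v) + u / v) / 2) = (v * v * m / u + u) * v / 2.
        by move=> u0 v0; field; rewrite u0 v0.
      by have := scaling (mb b * rb b) _ _ (lt0r_neq0 lam1) (lt0r_neq0 sd0); rewrite sdd.
    have : lam b / (1 + lam b) <= 1 by rewrite ler_pdivrMr // mul1r lerDr.
    move: (lam b / (1 + lam b)) => u u1.
    have : 0 <= Num.sqrt d * lam b by rewrite mulr_ge0 // ltW.
    have : u * Num.sqrt d <= 1 * Num.sqrt d by rewrite ler_wpM2r // ltW.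
    lra.
  rewrite -avgZ -(cavg_marginal L_gt0 _ (bsp b hb)); apply: eq_cavg => f hf.
  rewrite -{2}(gtr0_norm d0) -normrM mulrBr -/(lam b); congr (`|d * _ - _|).
  rewrite /D /l big_filter [RHS]big_mkcond /=; apply: eq_bigr => a _.
  have := hf b (bsp b hb); rewrite mem_sublists => /andP[/mem_subseq fs _].
  by case: (boolP (a \in f b)) => [/fs->//|_]; case: ifP.
- have -> : cavg L p ov = \sum_(a <- s) \sum_(b <- bs) \sum_(c <- bs | b != c)
      ((a \in s_ b)%:R * rb b) * ((a \in s_ c)%:R * rb c).
    rewrite cavg_sum; apply: eq_bigr => a _; rewrite cavg_sum.
    apply: eq_big_seq => b hb; rewrite -[RHS]big_filter.
    have -> : cavg L p (fun f => \sum_(c <- bs | b != c) (a \in f b)%:R * (a \in f c)%:R)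
        = cavg L p (fun f => \sum_(c <- [seq c <- bs | b != c]) (a \in f b)%:R * (a \in f c)%:R) :> R.
      by apply: eq_cavg => f _; rewrite big_filter.
    rewrite cavg_sum; apply: eq_big_seq => c; rewrite mem_filter => /andP[bc hc].
    rewrite (cavg_independent L_gt0 (fun t => (a \in t)%:R) (fun t => (a \in t)%:R)) ?bsp //.
    by rewrite !avg_mem ?s_size.
  apply: (@le_trans _ _ (d * \sum_(a <- s) \sum_(b <- bs) ((a \in s_ b)%:R * rb b * e))).
    rewrite ler_pM2l //; apply: ler_sum => a _; apply: ler_sum => b _.
    rewrite -mulr_sumr ler_wpM2l ?mulr_ge0 ?rb0 //.
    rewrite big_mkcond eE; apply: ler_sum => c _; case: ifP => _ //.
    by case: (a \in s_ c); rewrite ?mul1r ?mul0r.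
  have -> : d * \sum_(a <- s) \sum_(b <- bs) ((a \in s_ b)%:R * rb b * e) = Lam * e.
    rewrite exchange_big /= /Lam mulr_sumr mulr_suml; apply: eq_bigr => b _.
    have -> : lam b = d * ((\sum_(a <- s) (a \in s_ b)%:R) * rb b).
      rewrite /lam /mb -sum1_count natr_sum big_mkcond /=; congr (_ * (_ * _)).
      by apply: eq_bigr => a _; case: (a \in s_ b).
    by rewrite -!mulr_suml; ring.
  by rewrite mulrC ler_wpM2l // lerDr.
Qed.

End Vertex.

(** * Limits of products of exchange signs *)

Section Graph.
Context (R : realType).

Lemma cvg_sum_seq (J : Type) (l : seq J) (F : J -> nat -> R) (a : J -> R) :
  (forall j, F j @ \oo --> a j) ->
  (fun n => \sum_(j <- l) F j n) @ \oo --> \sum_(j <- l) a j.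
Proof.
move=> hF; elim: l => [|j l IHl].
  by under eq_fun => n do rewrite big_nil; rewrite big_nil; exact: cvg_cst.
under eq_fun => n do rewrite big_cons.
by rewrite big_cons; exact: cvgD.
Qed.

Lemma cvg_prod_seq (J : Type) (l : seq J) (F : J -> nat -> R) (a : J -> R) :
  (forall j, F j @ \oo --> a j) ->
  (fun n => \prod_(j <- l) F j n) @ \oo --> \prod_(j <- l) a j.
Proof.
move=> hF; elim: l => [|j l IHl].
  by under eq_fun => n do rewrite big_nil; rewrite big_nil; exact: cvg_cst.
under eq_fun => n do rewrite big_cons.
by rewrite big_cons; exact: cvgM.
Qed.

(** The sign picked up when two monomials with supports [t] and [t'] are
   interchanged: [-1] for each pair of distinct fermions, [t'] being
   repetition-free. *)
Definition exchange_sign (t t' : seq nat) : R :=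
  (-1) ^+ (size t * size t') * parity_sign R t t'.

Lemma norm_exchange_sign t t' : `|exchange_sign t t'| = 1.
Proof.
rewrite /exchange_sign normrM normrX normrN1 expr1n mul1r normr_prod big1 //.
by move=> a _; rewrite normrX normrN1 expr1n.
Qed.

Context (s_ : nat -> nat -> seq nat) (r_ : nat -> nat -> nat).

Definition mean_overlap (n a b : nat) : R :=
  (r_ n a)%:R * (r_ n b)%:R / n%:R * ((count (mem (s_ n b)) (s_ n a))%:R / n%:R).

Context (s_uniq : forall n b, uniq (s_ n b))
  (s_size : forall n b, (0 < n)%N -> size (s_ n b) = n)
  (r_bounds : forall n b, (0 < n)%N -> (0 < r_ n b <= n)%N)
  (r_small : forall b, (fun n => (r_ n b)%:R / n%:R : R) @ \oo --> (0 : R))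
  (Q : nat -> nat -> R)
  (Q_lim : forall a b, (fun n => (-1) ^+ (r_ n a * r_ n b)
     * expR (- (2 * mean_overlap n a b))) @ \oo --> Q a b).

Let L n b := sublists (s_ n b) (r_ n b).

Lemma near_small (c : nat) (f : nat -> nat) :
  (fun n => (f n)%:R / n%:R : R) @ \oo --> (0 : R) ->
  \forall n \near \oo, (c * f n <= n)%N.
Proof.
move=> /cvgrPdist_lt /(_ (c.+1)%:R^-1); rewrite invr_gt0 ltr0n => /(_ isT) h.
near=> n; have n0 : (0 < n)%N by near: n; exact: nbhs_infty_gt.
have n0' : (0 : R) < n%:R by rewrite ltr0n.
have : `|0 - (f n)%:R / n%:R| < c.+1%:R^-1 :> R by near: n.
rewrite sub0r normrN ger0_norm ?divr_ge0 // ltr_pdivrMr // mulrC.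
rewrite ltr_pdivlMr ?ltr0n // -natrM ltr_nat mulnS mulnC => /ltnW.
by apply: leq_trans; exact: leq_addl.
Unshelve. all: by end_near.
Qed.

(** Removing the last vertex replaces its edges by the product of their limits,
   up to an error that vanishes in mean. *)
Lemma graph_average p (E : seq (nat * nat)) :
  uniq E -> (forall e, e \in E -> (e.2 < e.1 < p)%N) ->
  (fun n => cavg (L n) p (fun f => \prod_(e <- E) exchange_sign (f e.1) (f e.2)))
    @ \oo --> \prod_(e <- E) Q e.1 e.2.
Proof.
elim: p E => [|p IHp] E uE hE.
  have -> : E = [::] by case: E hE {uE} => // e E /(_ e (mem_head _ _)) /andP[_].
  rewrite big_nil; under eq_fun => n do rewrite /= big_nil; exact: cvg_cst.
pose E0 := [seq e <- E | (e.1 < p)%N].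
pose bs := [seq e.2 | e <- E & e.1 == p].
have uE0 : uniq E0 by exact: filter_uniq.
have hE0 e : e \in E0 -> (e.2 < e.1 < p)%N.
  by rewrite mem_filter => /andP[-> /hE/andP[-> _]].
have ubs : uniq bs.
  rewrite map_inj_in_uniq ?filter_uniq // => -[a b] [a' b'].
  by rewrite !mem_filter /= => /andP[/eqP-> _] /andP[/eqP-> _] ->.
have hbs b : b \in bs -> (b < p)%N.
  by move=> /mapP[e]; rewrite mem_filter => /andP[/eqP <- /hE/andP[? _]] ->.
have split_edges (F : nat * nat -> R) :
    \prod_(e <- E) F e = \prod_(b <- bs) F (p, b) * \prod_(e <- E0) F e.
  rewrite (bigID (fun e => e.1 == p)) /=; congr (_ * _).
    rewrite big_map big_filter; apply: eq_bigr => -[a b] /= /eqP -> //.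
  rewrite big_filter big_seq_cond [RHS]big_seq_cond; apply: eq_bigl => e.
  case: (boolP (e \in E)) => //= /hE/andP[_]; rewrite ltnS leq_eqVlt.
  by case: ltngtP.
pose Y n := cavg (L n) p (fun f => \prod_(e <- E0) exchange_sign (f e.1) (f e.2)).
pose X n := cavg (L n) p.+1 (fun f => \prod_(e <- E) exchange_sign (f e.1) (f e.2)).
pose kap n : R := \prod_(b <- bs) ((-1) ^+ (r_ n p * r_ n b)
  * expR (- (2 * mean_overlap n p b))).
pose dl n : R := (r_ n p)%:R / n%:R.
pose ep n : R := \sum_(b <- bs) (r_ n b)%:R / n%:R.
pose err n : R := 4 * dl n + 2 * ep n + 4 * ((size bs)%:R * Num.sqrt (dl n) + ep n).
have ep0 : ep @ \oo --> (0 : R).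
  have -> : 0 = \sum_(b <- bs) 0 :> R by rewrite big1.
  exact: cvg_sum_seq.
have err0 : err @ \oo --> (0 : R).
  have -> : 0 = 4 * 0 + 2 * 0 + 4 * ((size bs)%:R * Num.sqrt 0 + 0) :> R.
    by rewrite sqrtr0 !(mulr0, addr0).
  have cs : (fun n => Num.sqrt (dl n)) @ \oo --> Num.sqrt (0 : R).
    by apply: continuous_cvg; [exact: sqrt_continuous|exact: r_small].
  apply: cvgD; first apply: cvgD; apply: cvgMr => //; first exact: r_small.
  by apply: cvgD => //; exact: cvgMr.
have XY : \forall n \near \oo, `|X n - kap n * Y n| <= err n.
  near=> n.
  have n0 : (0 < n)%N by near: n; exact: nbhs_infty_gt.
  have rp : (4 * r_ n p <= n)%N by near: n; exact: (near_small 4 (r_small p)).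
  have rbs : (2 * \sum_(b <- bs) r_ n b <= n)%N.
    near: n; apply: near_small; apply: cvg_trans ep0; apply: near_eq_cvg.
    by near=> m; rewrite /ep natr_sum mulr_suml.
  have r_le b : (r_ n b <= n)%N by have /andP[] := r_bounds b n0.
  have rgt0 b : (0 < r_ n b)%N by have /andP[] := r_bounds b n0.
  have ssz b : size (s_ n b) = n by exact: s_size.
  have L_gt0 b : (0 < size (L n b))%N by apply: size_sublists_gt0; rewrite ssz.
  have := vertex_average n0 (s_uniq n) ssz r_le (s_uniq n p) (ssz p) (rgt0 p)
            rp ubs hbs rbs (erefl (dl n)) (erefl (ep n)).
  rewrite -/(err n); apply: le_trans.
  pose eps : R := \prod_(b <- bs) (-1) ^+ (r_ n p * r_ n b).
  have neps : `|eps| = 1.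
    by rewrite normr_prod big1 // => b _; rewrite normrX normrN1 expr1n.
  have kapE : kap n = eps * expR (- (2 * \sum_(b <- bs) mean_overlap n p b)).
    rewrite /kap big_split /=; congr (_ * _).
    by rewrite mulr_sumr -sumrN expR_sum.
  have -> : X n = cavg (L n) p (fun f =>
      (\prod_(e <- E0) exchange_sign (f e.1) (f e.2)) *
      (eps * avg (L n p) (fun t => \prod_(b <- bs) parity_sign R t (f b)))).
    rewrite /X /=; apply: eq_cavg => f hf; rewrite -!avgZ; apply: eq_avg => t ht.
    rewrite split_edges mulrC; congr (_ * _).
      apply: eq_big_seq => e /hE0/andP[e1 e2] /=.
      by rewrite (ltn_eqF e2) (ltn_eqF (ltn_trans e1 e2)).
    rewrite /eps -big_split; apply: eq_big_seq => b hb /=.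
    rewrite eqxx (ltn_eqF (hbs b hb)) /exchange_sign.
    move: ht (hf b (hbs b hb)); rewrite !mem_sublists.
    by move=> /andP[_ /eqP->] /andP[_ /eqP->].
  rewrite /Y -cavgZ -cavgB; apply: le_trans (ler_norm_cavg _ _ _) _.
  apply: ler_cavg => f hf; rewrite kapE.
  rewrite [X in `|X|](_ : _ = (\prod_(e <- E0) exchange_sign (f e.1) (f e.2)) * eps *
    (avg (L n p) (fun t => \prod_(b <- bs) parity_sign R t (f b))
     - expR (- (2 * \sum_(b <- bs) mean_overlap n p b)))); last by ring.
  rewrite !normrM neps mulr1 normr_prod big1 ?mul1r // => e _.
  exact: norm_exchange_sign.
have XY0 : (fun n => X n - kap n * Y n) @ \oo --> (0 : R).
  apply/norm_cvg0P; apply: squeeze_cvgr err0; last exact: cvg_cst.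
  by near=> n; rewrite normr_ge0 /=; near: n.
rewrite split_edges.
rewrite -[X in _ --> X]add0r.
under eq_fun => n do rewrite -[cavg _ _ _](subrK (kap n * Y n)).
apply: cvgD => //; apply: cvgM; last exact: IHp.
apply: cvg_prod_seq => b; exact: Q_lim.
Unshelve. all: by end_near.
Qed.

End Graph.

(** * Sums over pairings *)

Section Pairings.
Context (R : realType) (X : choiceType).
Implicit Types (s : X -> X -> R) (w u : seq X).

(** Sum over the pairings of the letters of [w] in which paired letters agree,
   each crossing of two pairs being weighted by [s]. The letters are read in
   turn; [u] lists the letters still to be paired, the most recent first. A
   letter that closes a pair crosses exactly the pairs opened after its partner
   and still open. *)
Fixpoint pairing_sum s w u : R :=
  if w is x :: w' then
    pairing_sum s w' (x :: u) +
    \sum_(k < size u) (x == nth x u k)%:R * qprefix s x u k *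
                      pairing_sum s w' (delete_at u k)
  else (u == [::])%:R.

Lemma split_delete_at (x0 : X) u k : (k < size u)%N ->
  u = take k u ++ nth x0 u k :: drop k.+1 u.
Proof. by move=> ku; rewrite -drop_nth // cat_take_drop. Qed.

Lemma perm_delete_at (x0 : X) u k : (k < size u)%N ->
  perm_eq u (nth x0 u k :: delete_at u k).
Proof.
move=> ku; rewrite {1}(split_delete_at x0 ku) perm_sym -cat1s.
by rewrite /delete_at perm_catCA.
Qed.

Lemma subseq_delete_at u k : subseq (delete_at u k) u.
Proof.
rewrite /delete_at -{3}(cat_take_drop k u) cat_subseq //.
by rewrite -addn1 addnC -drop_drop drop_subseq.
Qed.

End Pairings.

Lemma map_delete_at (X Y : choiceType) (g : X -> Y) u k :
  map g (delete_at u k) = delete_at (map g u) k.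
Proof. by rewrite /delete_at map_cat map_take map_drop. Qed.

Section LabelledWords.
Context (R : realType) (I : choiceType) (L : I -> seq (seq nat)).

Fixpoint labelings (w : seq I) : seq (seq (I * seq nat)) :=
  if w is i :: w' then [seq (i, T) :: v | T <- L i, v <- labelings w']
  else [:: [::]].

Lemma big_labelings_cons (V : nmodType) i w (F : seq (I * seq nat) -> V) :
  \sum_(v <- labelings (i :: w)) F v =
  \sum_(T <- L i) \sum_(v <- labelings w) F ((i, T) :: v).
Proof. by rewrite /= big_allpairs_dep. Qed.

Lemma mem_labelings w v : v \in labelings w ->
  map fst v = w /\ (forall x, x \in v -> x.2 \in L x.1).
Proof.
elim: w v => [|i w IHw] v /=; first by rewrite inE => /eqP->.
move=> /allpairsP[[T v'] /= [hS /IHw [<- hv] ->]]; split=> // x.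
by rewrite inE => /orP[/eqP->|/hv].
Qed.

Let rootN i : R := Num.sqrt (size (L i))%:R.
Definition label_sign (x y : I * seq nat) : R := exchange_sign R x.2 y.2.

(** The normalization of each letter is shared between the two ends of its
   pair; an open letter has its normalization removed, so that opening a pair
   amounts to averaging over its set. *)
Definition pairing_avg (w : seq I) (u : seq (I * seq nat)) : R :=
  (\prod_(i <- w) (rootN i)^-1) * (\prod_(x <- u) rootN x.1) *
  \sum_(v <- labelings w) pairing_sum label_sign v u.

Lemma pairing_avg_nil u : pairing_avg [::] u = (u == [::])%:R.
Proof.
rewrite /pairing_avg /= big_nil big_seq1 mul1r.
by case: u => [|x u]; rewrite ?big_nil ?mul1r ?mulr0.
Qed.

Context (L_gt0 : forall i, (0 < size (L i))%N) (L_uniq : forall i, uniq (L i)).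

(** Closing a pair forces the set of the letter to be that of its partner, and
   the normalizations of both ends have already been accounted for when the pair
   was opened. *)
Lemma pairing_avg_cons i w u : (forall x, x \in u -> x.2 \in L x.1) ->
  pairing_avg (i :: w) u =
  avg (L i) (fun T => pairing_avg w ((i, T) :: u)) +
  \sum_(k < size u) (i == (nth (i, [::]) u k).1)%:R *
     qprefix label_sign (nth (i, [::]) u k) u k * pairing_avg w (delete_at u k).
Proof.
move=> uL.
have rN i' : rootN i' != 0 by rewrite sqrtr_eq0 -ltNge ltr0n.
have rNN i' : (size (L i'))%:R = rootN i' * rootN i'.
  by rewrite -expr2 sqr_sqrtr ?ler0n.
rewrite {1}/pairing_avg big_labelings_cons /=.
under [X in _ * X]eq_bigr => T _ do rewrite big_split /=.
rewrite big_split mulrDr; congr (_ + _).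
  rewrite /avg mulr_sumr mulr_sumr; apply: eq_bigr => T _.
  rewrite /pairing_avg !big_cons /= rNN; field; exact: rN.
rewrite [X in _ * X](_ : _ = \sum_(k < size u) (i == (nth (i, [::]) u k).1)%:R *
    qprefix label_sign (nth (i, [::]) u k) u k *
    \sum_(v <- labelings w) pairing_sum label_sign v (delete_at u k)); last first.
  under eq_bigr => T _ do rewrite exchange_big /=.
  rewrite exchange_big; apply: eq_bigr => k _ /=.
  under eq_bigr => T _ do rewrite -mulr_sumr.
  rewrite -mulr_suml; congr (_ * _); set y := nth (i, [::]) u k.
  have yu : y \in u by exact: mem_nth.
  under eq_bigr => T _ do rewrite (set_nth_default (i, [::])) // -/y.
  have [iy|iy] := eqVneq i y.1; last first.
    rewrite mul0r big1 // => T _; case: eqP => [h|_]; rewrite ?mul0r //.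
    by case/eqP: iy; rewrite -h.
  rewrite mul1r (bigD1_seq y.2) ?L_uniq ?iy ?uL //=.
  rewrite -surjective_pairing eqxx mul1r big1 ?addr0 // => T Sy.
  case: eqP => [h|_]; last by rewrite mul0r.
  by case/eqP: Sy; rewrite -h.
rewrite mulr_sumr; apply: eq_bigr => k _; rewrite /pairing_avg big_cons.
set y := nth (i, [::]) u k; have [iy|iy] := eqVneq i y.1; last first.
  by rewrite !(mul0r, mulr0).
rewrite (perm_big _ (perm_delete_at (i, [::]) (ltn_ord k))) big_cons -/y -iy.
by rewrite /= !mul1r; field; exact: rN.
Qed.

End LabelledWords.

Lemma cvg_ext (R : realType) (f g : nat -> R) (a : R) :
  f =1 g -> g @ \oo --> a -> f @ \oo --> a.
Proof. by move=> /funext ->. Qed.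

Section PairingLimit.
Context (R : realType) (I : choiceType).
Context (s_ : nat -> I -> seq nat) (r_ : nat -> I -> nat)
  (s_uniq : forall n i, uniq (s_ n i))
  (s_size : forall n i, (0 < n)%N -> size (s_ n i) = n)
  (r_bounds : forall n i, (0 < n)%N -> (0 < r_ n i <= n)%N)
  (r_small : forall i, (fun n => (r_ n i)%:R / n%:R : R) @ \oo --> (0 : R))
  (q : I -> I -> R)
  (q_lim : forall i j, (fun n => (-1) ^+ (r_ n i * r_ n j)
     * expR (- (2 * ((r_ n i)%:R * (r_ n j)%:R / n%:R
         * ((count (mem (s_ n j)) (s_ n i))%:R / n%:R))))) @ \oo --> q i j).

Lemma count_mem_sym (t t' : seq nat) : uniq t -> uniq t' ->
  count (mem t') t = count (mem t) t'.
Proof.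
move=> ut ut'; rewrite -!size_filter; apply/perm_size/uniq_perm.
- exact: filter_uniq.
- exact: filter_uniq.
- by move=> a; rewrite !mem_filter andbC.
Qed.

Lemma exchange_signC (t t' : seq nat) : uniq t -> uniq t' ->
  exchange_sign R t t' = exchange_sign R t' t.
Proof.
move=> ut ut'; rewrite /exchange_sign mulnC; congr (_ * _).
by rewrite /parity_sign !prod_sign_count; congr (_ ^+ _); exact: count_mem_sym.
Qed.

Lemma q_sym i j : q i j = q j i.
Proof.
rewrite -(cvg_lim (@Rhausdorff R) (@q_lim i j)) -(cvg_lim (@Rhausdorff R) (@q_lim j i)).
congr (lim (_ @ \oo)); apply/funext => n.
by rewrite mulnC count_mem_sym // (mulrC (r_ n i)%:R).
Qed.

Let L n i := sublists (s_ n i) (r_ n i).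

(** Reading the letters [K p], ..., [K (p + t).-1] after [p] letters have been
   read. The set attached to the letter in position [a] is [f a], and [E] records
   the crossings met so far, each as the pair of the opening positions, the
   larger one first; no pair of letters is recorded twice since crossing pairs
   are recorded when one of them closes. *)
Lemma pairing_avg_lim (K : nat -> I) t p u (E : seq (nat * nat)) :
  sorted gtn u -> (forall a, a \in u -> (a < p)%N) -> uniq E ->
  (forall e, e \in E -> (e.2 < e.1 < p)%N) ->
  (forall e, e \in E -> ~~ ((e.1 \in u) && (e.2 \in u))) ->
  (fun n => cavg (fun b => L n (K b)) p (fun f =>
      (\prod_(e <- E) exchange_sign R (f e.1) (f e.2)) *
      pairing_avg R (L n) [seq K j | j <- iota p t] [seq (K a, f a) | a <- u]))
    @ \oo -->
  (\prod_(e <- E) q (K e.1) (K e.2)) *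
  pairing_sum q [seq K j | j <- iota p t] [seq K a | a <- u].
Proof.
have graph p' (E' : seq (nat * nat)) := @graph_average R (fun n b => s_ n (K b))
  (fun n b => r_ n (K b)) (fun n b => s_uniq n (K b)) (fun n b => s_size (K b))
  (fun n b => r_bounds (K b)) (fun b => @r_small (K b)) (fun a b => q (K a) (K b))
  (fun a b => @q_lim (K a) (K b)) p' E'.
elim: t p u E => [|t IHt] p u E su up uE hE Eu.
  case: u su up Eu => [|a u] su up Eu.
    rewrite /= mulr1; apply: cvg_ext (graph p E uE hE) => n.
    by apply: eq_cavg => f _; rewrite pairing_avg_nil mulr1.
  rewrite /= mulr0; apply: cvg_ext (cvg_cst 0) => n.
  rewrite -[RHS](mul0r (cavg (fun b => L n (K b)) p (fun=> 0))) -cavgZ.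
  by apply: eq_cavg => f _; rewrite pairing_avg_nil mulr0 mul0r.
have gtn_trans : transitive gtn by move=> a b c ab ca; exact: ltn_trans ca ab.
have uu : uniq u by apply: sorted_uniq su => // a; exact: ltnn.
pose E' k := [seq (j, nth 0%N u k) | j <- take k u] ++ E.
have E'p (k : 'I_(size u)) e : e \in E' k -> (e.2 < e.1 < p)%N.
  rewrite mem_cat => /orP[/mapP[j ju ->]|/hE//] /=.
  rewrite up ?(mem_take ju) // andbT.
  move: su; rewrite (sorted_pairwise gtn_trans) {1}(split_delete_at 0%N (ltn_ord k)).
  by rewrite pairwise_cat => /and3P[/allrelP h _ _]; apply: h ju (mem_head _ _).
have limE : \forall n \near \oo,
    cavg (fun b => L n (K b)) p.+1 (fun f =>
      (\prod_(e <- E) exchange_sign R (f e.1) (f e.2)) *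
      pairing_avg R (L n) [seq K j | j <- iota p.+1 t] [seq (K a, f a) | a <- p :: u])
    + \sum_(k < size u) (K p == K (nth 0%N u k))%:R *
        cavg (fun b => L n (K b)) p.+1 (fun f =>
          (\prod_(e <- E' k) exchange_sign R (f e.1) (f e.2)) *
          pairing_avg R (L n) [seq K j | j <- iota p.+1 t]
            [seq (K a, f a) | a <- delete_at u k])
    = cavg (fun b => L n (K b)) p (fun f =>
      (\prod_(e <- E) exchange_sign R (f e.1) (f e.2)) *
      pairing_avg R (L n) [seq K j | j <- p :: iota p.+1 t] [seq (K a, f a) | a <- u]).
  near=> n.
  have n0 : (0 < n)%N by near: n; exact: nbhs_infty_gt.
  have L_gt0 i : (0 < size (L n i))%N.
    by apply: size_sublists_gt0; rewrite s_size //; have /andP[] := r_bounds i n0.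
  have L_uniq i : uniq (L n i) by exact: uniq_sublists.
  have uniqL i T : T \in L n i -> uniq T.
    by rewrite mem_sublists => /andP[/subseq_uniq-> //].
  have updE f T (l : seq nat) : (forall a, a \in l -> (a < p)%N) ->
      [seq (K a, [eta f with p |-> T] a) | a <- l] = [seq (K a, f a) | a <- l].
    by move=> lp; apply/eq_in_map => a /lp ap /=; rewrite ltn_eqF.
  have updP f T (l : seq (nat * nat)) : (forall e, e \in l -> (e.2 < e.1 < p)%N) ->
      \prod_(e <- l) exchange_sign R ([eta f with p |-> T] e.1) ([eta f with p |-> T] e.2) =
      \prod_(e <- l) exchange_sign R (f e.1) (f e.2).
    move=> lp; apply: eq_big_seq => e /lp/andP[e1 e2] /=.
    by rewrite (ltn_eqF e2) (ltn_eqF (ltn_trans e1 e2)).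
  have del_p k a : a \in delete_at u k -> (a < p)%N.
    by move=> /(mem_subseq (subseq_delete_at u k)) /up.
  have -> : cavg (fun b => L n (K b)) p.+1 (fun f =>
        (\prod_(e <- E) exchange_sign R (f e.1) (f e.2)) *
        pairing_avg R (L n) [seq K j | j <- iota p.+1 t] [seq (K a, f a) | a <- p :: u]) =
      cavg (fun b => L n (K b)) p (fun f =>
        (\prod_(e <- E) exchange_sign R (f e.1) (f e.2)) *
        avg (L n (K p)) (fun T => pairing_avg R (L n) [seq K j | j <- iota p.+1 t]
          ((K p, T) :: [seq (K a, f a) | a <- u]))).
    rewrite /=; apply: eq_cavg => f _; rewrite -avgZ; apply: eq_avg => T _.
    by rewrite updP // eqxx updE.
  under eq_bigr => k _ do rewrite -cavgZ.
  rewrite -cavg_sum -cavgD; apply: eq_cavg => f hf.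
  have fu x : x \in [seq (K a, f a) | a <- u] -> x.2 \in L n x.1.
    by move=> /mapP[a /up ap ->]; exact: hf.
  rewrite map_cons pairing_avg_cons // [RHS]mulrDr; congr (_ + _).
  rewrite size_map mulr_sumr avg_sum; apply: eq_bigr => k _; rewrite avgZ.
  rewrite (nth_map 0%N) //= -map_delete_at /qprefix -map_take big_map.
  rewrite (eq_avg (G := fun=> (\prod_(e <- E' k) exchange_sign R (f e.1) (f e.2)) *
     pairing_avg R (L n) [seq K j | j <- iota p.+1 t]
       [seq (K a, f a) | a <- delete_at u k])); last first.
    move=> T _; rewrite updP ?updE //; first exact: del_p.
    exact: E'p.
  rewrite avg_cst // /E' big_cat big_map /=.
  rewrite (_ : \prod_(j <- take k u) label_sign R _ _ =
    \prod_(j <- take k u) exchange_sign R (f j) (f (nth 0%N u k))); last first.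
    apply: eq_big_seq => j /mem_take /up ju; rewrite /label_sign /= exchange_signC //.
      by apply: (uniqL (K (nth 0%N u k))); apply/hf/up; exact: mem_nth.
    by apply: (uniqL (K j)); exact: hf.
  by ring.
apply: cvg_trans (near_eq_cvg limE) _; rewrite /= mulrDr; apply: cvgD.
  apply: (IHt p.+1 (p :: u)) => //.
  - by rewrite /= path_min_sorted //; apply/allP => a /up.
  - by move=> a; rewrite inE => /orP[/eqP->//|/up/ltnW].
  - by move=> e /hE/andP[-> /ltnW].
  - move=> e eE; rewrite !inE; have /andP[e1 e2] := hE e eE.
    by rewrite (ltn_eqF e2) (ltn_eqF (ltn_trans e1 e2)) Eu.
rewrite size_map mulr_sumr; apply: cvg_sum_seq => k.
rewrite (nth_map 0%N) // -map_delete_at.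
have [Kpk|_] := eqVneq (K p) (K (nth 0%N u k)); last first.
  by rewrite !mul0r mulr0; apply: cvg_ext (cvg_cst 0) => n; rewrite mul0r.
rewrite mul1r.
have -> : (\prod_(e <- E) q (K e.1) (K e.2)) * (qprefix q (K p) [seq K a | a <- u] k *
     pairing_sum q [seq K j | j <- iota p.+1 t] [seq K a | a <- delete_at u k]) =
   (\prod_(e <- E' k) q (K e.1) (K e.2)) *
     pairing_sum q [seq K j | j <- iota p.+1 t] [seq K a | a <- delete_at u k].
  rewrite mulrA; congr (_ * _); rewrite mulrC /E' big_cat big_map; congr (_ * _).
  rewrite /qprefix -map_take big_map; apply: eq_bigr => j _ /=.
  by rewrite q_sym Kpk.
apply: (cvg_ext (fun n => mul1r _)); apply: IHt.
- exact: (subseq_sorted gtn_trans (subseq_delete_at u k)).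
- by move=> a /(mem_subseq (subseq_delete_at u k)) /up /ltnW.
- rewrite cat_uniq uE andbT map_inj_uniq ?take_uniq // => [|a b []//].
  apply/hasPn => e eE; apply/mapP => -[j /mem_take ju ee].
  by have := Eu e eE; rewrite ee /= ju mem_nth.
- by move=> e /E'p/andP[-> /ltnW].
- move=> e; rewrite mem_cat => /orP[/mapP[j ju ->]|eE] /=.
    rewrite negb_and; apply/orP; right.
    have := uu; rewrite (perm_uniq (perm_delete_at 0%N (ltn_ord k))) /=.
    by move=> /andP[].
  apply: contra (Eu e eE) => /andP[].
  by move=> /(mem_subseq (subseq_delete_at u k)) -> /(mem_subseq (subseq_delete_at u k)) ->.
Unshelve. all: by end_near.
Qed.

End PairingLimit.

(** * Moments of the mixed q-Gaussian system *)

Section Fock.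
Context (R : realType) (I : choiceType) (q : I -> I -> R).
Implicit Types (u : seq I) (x y : fock R I).

Section Lift.
Context (f : seq I -> fock R I).

Lemma fgliftB x y : fglift f (x - y) = fglift f x - fglift f y.
Proof. exact: lift_is_additive. Qed.

Lemma fglift0 : fglift f 0 = 0.
Proof. by have := fgliftB 0 0; rewrite !subrr. Qed.

Lemma fgliftD x y : fglift f (x + y) = fglift f x + fglift f y.
Proof. by rewrite -{1}(opprK y) fgliftB -(sub0r y) fgliftB fglift0 sub0r opprK. Qed.

Lemma fglift_sum (J : Type) (l : seq J) (F : J -> fock R I) :
  fglift f (\sum_(j <- l) F j) = \sum_(j <- l) fglift f (F j).
Proof. exact: (big_morph _ fgliftD fglift0). Qed.

Lemma fgliftZ c x : fglift f (c *: x) = c *: fglift f x.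
Proof.
have -> : c *: x = \sum_(z <- dom x) << c * coeff z x *g z >> by [].
rewrite -{3}[x]freeg_sumE !fglift_sum scaler_sumr.
by apply: eq_bigr => z _; rewrite !liftU scalerA.
Qed.

End Lift.

Lemma qgaussianD i x y : qgaussian q i (x + y) = qgaussian q i x + qgaussian q i y.
Proof. by rewrite /qgaussian /creation /annihilation !fgliftD addrACA. Qed.

Lemma qgaussianZ i c x : qgaussian q i (c *: x) = c *: qgaussian q i x.
Proof. by rewrite /qgaussian /creation /annihilation !fgliftZ scalerDr. Qed.

Lemma qgaussian_tensor i u : qgaussian q i (tensor R u) = tensor R (i :: u) +
  \sum_(k < size u) ((i == nth i u k)%:R * ((qprefix q i u k)%:C)%C)
                    *: tensor R (delete_at u k).
Proof. by rewrite /qgaussian /creation /annihilation !liftU !scale1r. Qed.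

Section Words.
Context (J : Type) (k : J -> I).
Local Notation word l := (\big[comp/idfun]_(j <- l) qgaussian q (k j)).

Lemma word_rcons l j x : word (rcons l j) x = word l (qgaussian q (k j) x).
Proof.
elim: l => [|j' l IHl] /=; first by rewrite big_cons !big_nil.
by rewrite !big_cons /= IHl.
Qed.

Lemma wordD l x y : word l (x + y) = word l x + word l y.
Proof.
elim: l => [|j l IHl]; first by rewrite !big_nil.
by rewrite !big_cons /= IHl qgaussianD.
Qed.

Lemma wordZ l c x : word l (c *: x) = c *: word l x.
Proof.
elim: l => [|j l IHl]; first by rewrite !big_nil.
by rewrite !big_cons /= IHl qgaussianZ.
Qed.

(** The operator nearest to the vector acts first, so that the word is read
   backwards; what creation and annihilation do to a tensor is what opening and
   closing a pair does to the list of open letters. *)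
Lemma coeff_word l u : coeff [::] (word l (tensor R u)) =
  ((pairing_sum q (rev [seq k j | j <- l]) u)%:C)%C.
Proof.
elim/last_ind: l u => [|l j IHl] u.
  by rewrite big_nil /= coeffU mul1r; case: (u == [::]).
rewrite word_rcons qgaussian_tensor wordD coeffD IHl map_rcons rev_rcons /=.
rewrite rmorphD /=; congr (_ + _).
have word0 : word l 0 = 0 by have := wordZ l 0 0; rewrite !scale0r.
rewrite (big_morph _ (wordD l) word0) raddf_sum rmorph_sum /=.
apply: eq_bigr => m _; rewrite wordZ coeffZ IHl.
by rewrite !rmorphM /= rmorph_nat.
Qed.

End Words.

Lemma vacuum_state_coeff (a : fock R I -> fock R I) :
  vacuum_state q a = coeff [::] (a (vacuum R I)).
Proof.
rewrite /vacuum_state /qform; set x := a _.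
rewrite /vacuum /tensor domU1; under eq_bigr => u _ do
  rewrite big_seq1 coeffU eqxx mulr1 conjc1 mulr1.
rewrite [LHS](_ : _ = \sum_(u <- dom x) coeff u x * (u == [::])%:R); last first.
  apply: eq_bigr => -[|i u] _ //=; rewrite big_ord0 //.
have [xN|xN] := boolP ([::] \in dom x).
  rewrite (bigD1_seq [::]) ?uniq_dom //= mulr1 big1 ?addr0 // => u /negbTE->.
  by rewrite mulr0.
rewrite coeff_outdom // big_seq big1 // => u ux.
by case: eqP => [u0|_]; rewrite ?mulr0 //; move: xN; rewrite -u0 ux.
Qed.

Lemma vacuum_state_pairing_sum l (k : 'I_l -> I) :
  vacuum_state q (\big[comp/idfun]_(j < l) qgaussian q (k j)) =
  ((pairing_sum q (rev [seq k j | j <- index_enum 'I_l]) [::])%:C)%C.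
Proof. by rewrite vacuum_state_coeff coeff_word. Qed.

End Fock.

(** * Products of Majorana monomials *)

Section Majorana.
Context (R : realType) (M : algType R[i]) (star : M -> M) (psi : nat -> M)
  (psi_majorana : is_majorana star psi).
Local Notation C := R[i].
Implicit Types (s t : seq nat) (a b : nat).

Local Notation monomial s := (\prod_(a <- s) psi a).

Lemma psi_sqr a : psi a * psi a = 1.
Proof.
have := (psi_majorana.2 a a); rewrite eqxx mulr1 => h.
have two : (2 : C) != 0 by rewrite pnatr_eq0.
by apply: (scalerI two); rewrite !scaler_nat mulr2n h.
Qed.

Lemma psi_anticommute a b : a != b -> psi a * psi b = - (psi b * psi a).
Proof.
move=> /negbTE ab; have := psi_majorana.2 a b; rewrite ab mulr0 => /eqP.
by rewrite addr_eq0 => /eqP.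
Qed.

Lemma psi_monomialC a s :
  psi a * monomial s = (-1) ^+ (size s + count_mem a s) *: (monomial s * psi a).
Proof.
elim: s => [|b s IHs]; first by rewrite !big_nil mulr1 mul1r scale1r.
rewrite big_cons mulrA; case: (eqVneq a b) IHs => [->|ab] IHs.
  rewrite -(mulrA _ (psi b) (monomial s)) {1}IHs -scalerAr mulrA /= eqxx; congr (_ *: _).
  by rewrite addSn addnCA add1n !exprS mulrA mulrNN mul1r mul1r addnC.
rewrite psi_anticommute // mulNr -(mulrA _ (psi a) (monomial s)) IHs -scalerAr mulrA /=.
rewrite eq_sym (negbTE ab) add0n addSn.
by rewrite exprS mulN1r scaleNr.
Qed.

Lemma monomialC s t : uniq t ->
  monomial s * monomial t = ((exchange_sign R s t)%:C)%C *: (monomial t * monomial s).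
Proof.
move=> ut; elim: s => [|a s IHs].
  by rewrite /exchange_sign /parity_sign !big_nil mul0n !mulr1 mul1r scale1r.
rewrite big_cons -(mulrA _ (monomial s)) IHs -scalerAr (mulrA (psi a)).
rewrite psi_monomialC -scalerAl scalerA -mulrA.
congr (_ *: _); rewrite /exchange_sign /parity_sign big_cons (count_uniq_mem _ ut) /=.
rewrite mulSn !exprD !rmorphM /= !rmorphXn /= rmorphN1; ring.
Qed.

Lemma monomial_sqr s : uniq s -> monomial s * monomial s = ((-1) ^+ (size s)./2 : C) *: 1.
Proof.
elim: s => [|a s IHs] /=; first by rewrite big_nil mulr1 scale1r.
move=> /andP[as_ us]; rewrite big_cons -(mulrA (psi a)) (mulrA _ (psi a)).
have := psi_monomialC a s; rewrite (count_uniq_mem _ us) (negbTE as_) addn0.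
move=> /(congr1 (fun x => (-1) ^+ size s *: x)); rewrite scalerA -expr2 sqrr_sign scale1r => <-.
rewrite -scalerAl -scalerAr -!mulrA IHs // mulrA psi_sqr mul1r scalerA.
by rewrite uphalf_half exprD signr_odd.
Qed.

(** The last clause, on lower bounds, is what keeps the result sorted when the
   fermion has to move past the first factors. *)
Lemma monomial_insert a t : sorted ltn t ->
  exists t' (e : C), [/\ sorted ltn t', e = 1 \/ e = -1,
    psi a * monomial t = e *: monomial t' &
    forall b, (b < a)%N -> all (ltn b) t -> all (ltn b) t'].
Proof.
elim: t => [|c t IHt] /=.
  move=> _; exists [:: a], 1; split=> //; first by left.
    by rewrite big_seq1 big_nil mulr1 scale1r.
  by move=> b ba _ /=; rewrite ba.
rewrite (path_sortedE ltn_trans) => /andP[ct st]; have [ac|ca|<-] := ltngtP a c.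
- exists [:: a, c & t], 1; split; [| by left | by rewrite scale1r !big_cons |].
    by rewrite /= ac (path_sortedE ltn_trans) ct.
  by move=> b ba /= ->; rewrite ba.
- have [t' [e [st' he ht' hb]]] := IHt st.
  exists (c :: t'), (- e); split.
  + by rewrite /= (path_sortedE ltn_trans) st' hb.
  + by case: he => ->; [right|left]; rewrite ?opprK.
  + rewrite !big_cons mulrA psi_anticommute; last by rewrite neq_ltn ca orbT.
    by rewrite mulNr -(mulrA _ (psi a)) ht' -scalerAr scaleNr.
  + by move=> b ba /= /andP[-> /(hb b ba)].
- exists t, 1; split=> //; first by left.
    by rewrite big_cons mulrA psi_sqr mul1r scale1r.
  by move=> b _ /= /andP[].
Qed.

Lemma monomial_normal_form s : exists t (e : C),
  [/\ sorted ltn t, e = 1 \/ e = -1 & monomial s = e *: monomial t].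
Proof.
elim: s => [|a s [t [e [st he hs]]]].
  by exists [::], 1; split=> //; [left|rewrite scale1r].
have [t' [e' [st' he' ht' _]]] := monomial_insert a st.
exists t', (e * e'); split=> //.
  by case: he => ->; case: he' => ->; rewrite ?mul1r ?mulN1r ?opprK; [left|right|right|left].
by rewrite big_cons hs -scalerAr ht' scalerA.
Qed.

(** The phase makes the monomial a self-adjoint unitary. *)
Definition unit_monomial s : M := ('i%C : C) ^+ (size s %/ 2) *: monomial s.

Lemma unit_monomial_sqr s : uniq s -> unit_monomial s * unit_monomial s = 1.
Proof.
move=> us; rewrite /unit_monomial -scalerAl -scalerAr monomial_sqr // !scalerA divn2.
by rewrite -!exprMn -expr2 sqr_i mulrNN mul1r expr1n scale1r.
Qed.

Lemma unit_monomialC s t : uniq t -> unit_monomial s * unit_monomial t =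
  ((exchange_sign R s t)%:C)%C *: (unit_monomial t * unit_monomial s).
Proof.
move=> ut; rewrite /unit_monomial -!scalerAl -!scalerAr monomialC // !scalerA.
by congr (_ *: _); ring.
Qed.

Context (tr : M -> C) (tr_trace : is_normalized_trace psi tr).

Lemma generated_prod (J : Type) (l : seq J) (F : J -> M) :
  (forall j, generated psi (F j)) -> generated psi (\prod_(j <- l) F j).
Proof.
move=> hF; elim: l => [|j l IHl]; first by rewrite big_nil; exact: generated1.
by rewrite big_cons; exact: generatedM.
Qed.

Lemma generated_sum (J : Type) (l : seq J) (F : J -> M) :
  (forall j, generated psi (F j)) -> generated psi (\sum_(j <- l) F j).
Proof.
move=> hF; elim: l => [|j l IHl]; last by rewrite big_cons; exact: generatedD.
by rewrite big_nil -(scale0r 1); apply: generatedZ; exact: generated1.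
Qed.

Lemma generated_unit_monomial s : generated psi (unit_monomial s).
Proof. by apply: generatedZ; apply: generated_prod => a; exact: generated_gen. Qed.

Lemma tr_sum (J : Type) (l : seq J) (F : J -> M) :
  (forall j, generated psi (F j)) -> tr (\sum_(j <- l) F j) = \sum_(j <- l) tr (F j).
Proof.
move=> hF; elim: l => [|j l IHl].
  rewrite !big_nil -(scale0r 1) (trZ tr_trace) ?mul0r //; exact: generated1.
by rewrite !big_cons (trD tr_trace) ?IHl //; exact: generated_sum.
Qed.

Context (I : choiceType).
Implicit Types (x : I * seq nat) (u w : seq (I * seq nat)).

Definition word_trace u : C := tr (\prod_(x <- u) unit_monomial x.2).

(** A product of monomials is a unimodular multiple of an ordered monomial, whose
   trace is zero or one. *)
Lemma norm_word_trace u : `|word_trace u| <= 1.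
Proof.
have flat : exists (e : C) s, `|e| = 1 /\ \prod_(x <- u) unit_monomial x.2 = e *: monomial s.
  elim: u => [|x u [e [s [he hs]]]].
    by exists 1, [::]; rewrite normr1 !big_nil scale1r.
  exists ('i%C ^+ (size x.2 %/ 2) * e), (x.2 ++ s); split.
    by rewrite normrM he mulr1 normrX normc_def /= expr0n expr1n add0r sqrtr1 expr1n.
  by rewrite big_cons hs big_cat /= /unit_monomial -scalerAl -scalerAr scalerA.
have [e [s [he]]] := flat; rewrite /word_trace => ->.
have [t [e' [st he' ->]]] := monomial_normal_form s.
have gt : generated psi (monomial t) by apply: generated_prod => a; exact: generated_gen.
rewrite scalerA (trZ tr_trace) // !normrM he mul1r.
have -> : `|e'| = 1 by case: he' => ->; rewrite ?normrN1 ?normr1.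
rewrite mul1r; case: t st {gt} => [|a t] st.
  by rewrite big_nil (tr1 tr_trace) normr1.
by rewrite (tr_monomial tr_trace) // normr0 ler01.
Qed.

Lemma unit_monomial_prodC x (l : seq (I * seq nat)) :
  (forall y, y \in l -> uniq y.2) ->
  unit_monomial x.2 * \prod_(y <- l) unit_monomial y.2 =
  ((\prod_(y <- l) label_sign R x y)%:C)%C *:
  (\prod_(y <- l) unit_monomial y.2 * unit_monomial x.2).
Proof.
elim: l => [|y l IHl] ul; first by rewrite !big_nil mulr1 mul1r scale1r.
rewrite !big_cons mulrA unit_monomialC ?ul ?mem_head // -scalerAl.
rewrite -(mulrA _ (unit_monomial x.2)) IHl => [|z zl]; last by rewrite ul // in_cons zl orbT.
by rewrite -scalerAr scalerA [in RHS]rmorphM /= mulrA.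
Qed.

(** Moving [x] to the right until it meets its partner, which it cancels. *)
Lemma word_trace_close x u v (k : 'I_(size u)) : x = nth x u k ->
  (forall y, y \in u -> uniq y.2) ->
  word_trace (v ++ x :: u) =
  ((qprefix (label_sign R (I:=I)) x u k)%:C)%C * word_trace (v ++ delete_at u k).
Proof.
move=> xk uu; rewrite /word_trace -(trZ tr_trace); last first.
  by apply: generated_prod => y; exact: generated_unit_monomial.
congr tr; rewrite /delete_at !big_cat big_cons /=.
rewrite [X in unit_monomial _ * \prod_(y <- X) _](split_delete_at x (ltn_ord k)).
rewrite big_cat big_cons -xk /= [unit_monomial _ * (_ * _)]mulrA.
rewrite unit_monomial_prodC => [|y /mem_take /uu//].
rewrite -scalerAl -scalerAr -[_ * unit_monomial _ * _]mulrA.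
rewrite [unit_monomial _ * (_ * _)]mulrA unit_monomial_sqr ?mul1r //.
by apply: uu; rewrite xk mem_nth.
Qed.

(** Each pairing of equal labels evaluates the trace by bringing paired
   monomials together, which exchanges each with those it crosses. *)
Lemma word_trace_pairing w u :
  (forall x, x \in w -> uniq x.2) -> (forall x, x \in u -> uniq x.2) ->
  word_trace (rev w ++ u) * ((pairing_sum (fun _ _ => 1) w u)%:C)%C =
  ((pairing_sum (label_sign R (I:=I)) w u)%:C)%C.
Proof.
elim: w u => [|x w IHw] u uw uu.
  rewrite /=; case: u uu => [|x u] _; last by rewrite mulr0.
  by rewrite /word_trace big_nil (tr1 tr_trace) mul1r.
have uw' y : y \in w -> uniq y.2 by move=> yw; rewrite uw // in_cons yw orbT.
rewrite rev_cons cat_rcons /= !rmorphD /= mulrDr; congr (_ + _).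
  apply: IHw => // y; rewrite in_cons => /orP[/eqP->|/uu//].
  by rewrite uw ?mem_head.
rewrite !rmorph_sum mulr_sumr; apply: eq_bigr => k _ /=.
have [xk|_] := eqVneq x (nth x u k); last by rewrite !mul0r mulr0.
rewrite !mul1r {1}/qprefix big1_eq mul1r rmorphM /= (word_trace_close _ xk) //.
rewrite -mulrA IHw // => y /(mem_subseq (subseq_delete_at u k)); exact: uu.
Qed.

End Majorana.

(** * Expansion of the Hamiltonians *)

Section Hamiltonian.

Definition index_list (A : {fset nat}) : seq nat := sort leq (enum_fset A).

Lemma mem_index_list (A : {fset nat}) a : (a \in index_list A) = (a \in A).
Proof. by rewrite mem_sort. Qed.

Lemma uniq_index_list (A : {fset nat}) : uniq (index_list A).
Proof. by rewrite sort_uniq fset_uniq. Qed.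

Lemma size_index_list (A : {fset nat}) : size (index_list A) = #|` A|.
Proof. by rewrite size_sort. Qed.

Lemma sorted_index_list (A : {fset nat}) : sorted ltn (index_list A).
Proof.
rewrite ltn_sorted_uniq_leq uniq_index_list /=; apply: sort_sorted.
exact: leq_total.
Qed.

Lemma mem_sublists_index_list (A : {fset nat}) r t :
  (t \in sublists (index_list A) r) = index_tuple A r t.
Proof.
rewrite mem_sublists /index_tuple andbC; congr (_ && _); apply/idP/andP.
  move=> ts; split; first exact: (subseq_sorted ltn_trans ts (sorted_index_list A)).
  by apply/allP => a /(mem_subseq ts); rewrite mem_index_list.
move=> [st /allP tA]; suff -> : t = [seq a <- index_list A | a \in t] by exact: filter_subseq.
apply: (irr_sorted_eq ltn_trans ltnn) => //.
  exact: (sorted_filter ltn_trans _ (sorted_index_list A)).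
move=> a; rewrite mem_filter mem_index_list /=.
by case: (boolP (a \in t)) => // /tA ->.
Qed.

Context (R : realType) (M : algType R[i]) (psi : nat -> M).

(** The normalization is kept apart from the phase, which belongs to the
   monomials. *)
Lemma syk_hamiltonianE n (A : {fset nat}) r (J : seq nat -> R) :
  syk_hamiltonian psi n A r J = (((Num.sqrt ('C(n, r))%:R)^-1)%:C)%C *:
  \sum_(t <- sublists (index_list A) r) ((J t)%:C)%C *: unit_monomial psi t.
Proof.
rewrite /syk_hamiltonian mulrC fmorphV -scalerA; congr (_ *: _); rewrite scaler_sumr.
pose vals (t : r.-tuple A) : seq nat := [seq val a | a <- t].
have perm : perm_eq [seq vals t | t <- index_enum (r.-tuple A : finType)
    & sorted ltn (vals t)] (sublists (index_list A) r).
  apply: uniq_perm.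
  - rewrite map_inj_uniq; first by rewrite filter_uniq // index_enum_uniq.
    by move=> t t' /(inj_map val_inj) /val_inj.
  - exact/uniq_sublists/uniq_index_list.
  - move=> t; rewrite mem_sublists_index_list; apply/mapP/idP => [[t']|].
      rewrite mem_filter => /andP[st' _] ->.
      rewrite /index_tuple size_map size_tuple eqxx st' /=.
      by apply/allP => a /mapP[b _ ->]; exact: valP.
    move=> /and3P[/eqP sz st /allP tA].
    pose t' : seq A := pmap insub t.
    have tt' : map val t' = t.
      rewrite /t' pmap_filter; last exact: insubK.
      by apply/all_filterP/allP => a /tA aA; rewrite /= insubT.
    have sz' : size t' == r by rewrite -sz -[in X in _ == X]tt' size_map.
    exists (Tuple sz'); last by rewrite /vals /= tt'.
    by rewrite mem_filter mem_index_enum andbT /vals /= tt'.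
rewrite -(perm_big _ perm) big_map big_filter /=; apply: eq_bigr => t _.
rewrite /unit_monomial !scalerA [in RHS]mulrC /vals size_map size_tuple big_map.
by [].
Qed.

End Hamiltonian.

(** * Moments of products of independent variables *)

Section Independence.
Context (d : measure_display) (T : measurableType d) (R : realType)
  (P : probability T R).

Section Pair.
Context (Y h : T -> R) (mY : measurable_fun setT Y) (mh : measurable_fun setT h)
  (h0 : forall w, 0 <= h w)
  (h_fin : (\int[P]_w (h w)%:E)%E \is a fin_num)
  (Yh : forall B : set R, measurable B ->
    (\int[P]_w (\1_B (Y w) * h w)%:E =
     (\int[P]_w (\1_B (Y w))%:E) * \int[P]_w (h w)%:E)%E).

Import HBNNSimple.

Let measurable_indicY (B : set R) : measurable B ->
  measurable_fun setT (fun w => \1_B (Y w) : R).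
Proof. by move=> mB; apply: (measurableT_comp _ mY); exact/measurable_indicP. Qed.

Let nnsfun_integral (f : {nnsfun R >-> R}) (k : T -> R) :
  measurable_fun setT k -> (forall w, 0 <= k w) ->
  (\int[P]_w (f (Y w) * k w)%:E =
   \sum_(z <- fset_set (range f))
     (Num.max z 0)%:E * \int[P]_w (\1_(f @^-1` [set z]) (Y w) * k w)%:E)%E.
Proof.
move=> mk k0.
have mB z : measurable (f @^-1` [set z]) by [].
have mI z : measurable_fun setT (fun w => (\1_(f @^-1` [set z]) (Y w) * k w)%:E).
  by apply/measurable_EFinP; apply: measurable_funM => //; exact: measurable_indicY.
have I0 z w : (0 <= (\1_(f @^-1` [set z]) (Y w) * k w)%:E)%E.
  by rewrite lee_fin mulr_ge0 // indicE ler0n.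
under [RHS]eq_bigr => z _.
  rewrite -ge0_integralZl_EFin; [|by []|by []|exact: mI|by rewrite le_max lexx orbT].
  over.
rewrite -ge0_integral_sum //; first 1 last.
- by move=> z; apply: measurable_funeM; exact: mI.
- by move=> z w _; rewrite mule_ge0 ?I0 // lee_fin le_max lexx orbT.
apply: eq_integral => w _; rewrite sumEFin; congr EFin.
rewrite [in LHS]fimfunE fsbig_finite //= mulr_suml; apply: eq_bigr => z _.
rewrite mulrA; congr (_ * _); rewrite indicE.
have [zY|_] := boolP (Y w \in f @^-1` [set z]); last by rewrite !mulr0.
rewrite max_l //; move: zY; rewrite inE /= => <-; exact: fun_ge0.
Qed.

(** The identity for indicators extends to simple functions by linearity and to
   nonnegative measurable functions by monotone limits. *)
Lemma ge0_integral_indep (g : R -> R) : measurable_fun setT g ->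
  (forall y, 0 <= g y) ->
  (\int[P]_w (g (Y w) * h w)%:E = (\int[P]_w (g (Y w))%:E) * \int[P]_w (h w)%:E)%E.
Proof.
move=> mg g0.
have mEg : measurable_fun setT (EFin \o g) by exact/measurable_EFinP.
pose gn := nnsfun_approx measurableT mEg.
have step n : (\int[P]_w (gn n (Y w) * h w)%:E =
    (\int[P]_w (gn n (Y w) * cst 1 w)%:E) * \int[P]_w (h w)%:E)%E.
  rewrite !nnsfun_integral // ge0_sume_distrl; last first.
    move=> z _; rewrite mule_ge0 ?lee_fin ?le_max ?lexx ?orbT //.
    by apply: integral_ge0 => w _; rewrite lee_fin mulr_ge0 // indicE ler0n.
  apply: eq_bigr => z _; rewrite -muleA Yh //; congr (_ * (_ * _))%E.
  by apply: eq_integral => w _; rewrite mulr1.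
have conv (k : T -> R) : measurable_fun setT k -> (forall w, 0 <= k w) ->
    ((\int[P]_w (gn n (Y w) * k w)%:E)%E @[n --> \oo] --> (\int[P]_w (g (Y w) * k w)%:E)%E).
  move=> mk k0.
  have lim_gn w : ((gn n (Y w) * k w)%:E @[n --> \oo] --> (g (Y w) * k w)%:E).
    rewrite EFinM; under eq_fun => n do rewrite EFinM.
    apply: cvgeZr => //.
    by apply: (cvg_nnsfun_approx measurableT mEg) => // y _; rewrite /= lee_fin.
  have -> : (\int[P]_w (g (Y w) * k w)%:E)%E =
      (\int[P]_w (limn (fun n => (gn n (Y w) * k w)%:E)))%E.
    by apply: eq_integral => w _; rewrite (cvg_lim (@ereal_hausdorff R) (lim_gn w)).
  apply: cvg_monotone_convergence => //.
  - move=> n; apply/measurable_EFinP/measurable_funM => //.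
    exact: measurableT_comp.
  - by move=> n w _; rewrite lee_fin mulr_ge0 //; exact: fun_ge0.
  - move=> w _ m n mn; rewrite lee_fin ler_wpM2r //.
    by have /lefP := nd_nnsfun_approx measurableT mEg mn; exact.
have c1 := conv _ mh h0; have c2 := conv (cst 1) (measurable_cst _) (fun=> ler01).
have -> : (\int[P]_w (g (Y w))%:E = \int[P]_w (g (Y w) * cst 1 w)%:E)%E.
  by apply: eq_integral => w _; rewrite mulr1.
apply: (cvg_unique _ c1) => //.
by rewrite (funext step); exact: cvgeZr.
Qed.

End Pair.

Context (K : choiceType) (D : set K) (X : K -> {RV P >-> R})
  (X_indep : mutually_independent D X).
Implicit Types (l : seq K) (g : K -> R -> R).

Let mX a : measurable_fun setT (X a). Proof. by []. Qed.

Let measurable_prodX l g : (forall a, measurable_fun setT (g a)) ->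
  measurable_fun setT (fun w => \prod_(a <- l) g a (X a w)).
Proof.
by move=> mg; apply: measurable_prod => a _; exact: (measurableT_comp (mg a) (mX a)).
Qed.

Lemma indic_independent l (B : K -> set R) : uniq l -> (forall a, a \in l -> D a) ->
  (forall a, measurable (B a)) ->
  (\int[P]_w (\prod_(a <- l) \1_(B a) (X a w))%:E =
   (\prod_(a <- l) fine (\int[P]_w (\1_(B a) (X a w))%:E))%:E)%E.
Proof.
move=> ul lD mB; pose F := [fset a in l]%fset.
have FD a : a \in F -> D a by rewrite inE /= => /lD.
have mXB a : measurable (X a @^-1` B a) by rewrite -[X in measurable X]setTI; exact: mX.
have := X_indep FD (fun a _ => mB a).
have pF : perm_eq (enum_fset F) l.
  by apply: uniq_perm => // a; rewrite /F /= inE.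
rewrite (perm_big _ pF) /= => h.
have indE a : (\int[P]_w (\1_(B a) (X a w))%:E = P (X a @^-1` B a))%E.
  by rewrite -[in RHS](setIT (X a @^-1` B a)) -integral_indic.
have -> : (\int[P]_w (\prod_(a <- l) \1_(B a) (X a w))%:E =
    P (\bigcap_(a in [set a | a \in F]) X a @^-1` B a))%E.
  rewrite -[in RHS](setIT (\bigcap_(a in _) _)) -integral_indic //; last first.
    by apply: fin_bigcap_measurable.
  apply: eq_integral => w _; congr EFin; rewrite [RHS]indicE.
  have -> : (w \in \bigcap_(a in [set a | a \in F]) X a @^-1` B a) =
      all (fun a => X a w \in B a) l.
    apply/idP/allP => [|hl]; rewrite ?inE /=.
      by move=> hw a al; rewrite inE; apply: hw; rewrite /= inE.
    by move=> a /=; rewrite inE => /hl; rewrite inE.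
  elim: l {ul lD F FD h pF} => [|a l IHl]; first by rewrite big_nil.
  by rewrite big_cons IHl indicE -natrM mulnb.
rewrite h; elim: l {ul lD F FD h pF} => [|a l IHl]; first by rewrite !big_nil.
by rewrite !big_cons IHl indE EFinM fineK // fin_num_measure.
Qed.

Lemma prod_update l a (k : R -> R) g w : a \in l -> uniq l ->
  \prod_(b <- l) [eta g with a |-> k] b (X b w) =
  k (X a w) * \prod_(b <- rem a l) g b (X b w).
Proof.
move=> al ul; rewrite (perm_big _ (perm_to_rem al)) big_cons /= eqxx; congr (_ * _).
apply: eq_big_seq => b; rewrite mem_rem_uniq // inE => /andP[/= ba _].
by rewrite (negbTE ba).
Qed.

Lemma prod_fine_update l a (k : R -> R) g : a \in l -> uniq l ->
  \prod_(b <- l) fine (\int[P]_w ([eta g with a |-> k] b (X b w))%:E)%E =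
  fine (\int[P]_w (k (X a w))%:E)%E *
  \prod_(b <- rem a l) fine (\int[P]_w (g b (X b w))%:E)%E.
Proof.
move=> al ul; rewrite (perm_big _ (perm_to_rem al)) big_cons /= eqxx; congr (_ * _).
apply: eq_big_seq => b; rewrite mem_rem_uniq // inE => /andP[/= ba _].
by rewrite (negbTE ba).
Qed.

(** Indicators are replaced by nonnegative functions one at a time: those outside
   [l1] are still indicators. *)
Let ge0_prod_independent l l1 g : uniq l -> (forall a, a \in l -> D a) ->
  (forall a, measurable_fun setT (g a)) -> (forall a y, 0 <= g a y) ->
  (forall a, a \in l -> (\int[P]_w (g a (X a w))%:E)%E \is a fin_num) ->
  (forall a, a \in l -> a \notin l1 -> exists2 B, measurable B & g a = \1_B) ->
  (\int[P]_w (\prod_(a <- l) g a (X a w))%:E =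
   (\prod_(a <- l) fine (\int[P]_w (g a (X a w))%:E))%:E)%E.
Proof.
elim: l1 l g => [|a l1 IHl1] l g ul lD mg g0 gfin gB.
  pose B a := g a @^-1` [set 1].
  have mB a : measurable (B a) by rewrite -[X in measurable X]setTI; exact: mg.
  have gE a : a \in l -> g a = \1_(B a).
    move=> al; have [//|A _ gA] := gB a al; rewrite /B gA; apply/funext => y.
    rewrite !indicE; congr (nat_of_bool _)%:R; apply/idP/idP => [yA|].
      by rewrite inE /= indicE yA.
    by rewrite inE /= indicE; case: (y \in A) => //= /esym/eqP; rewrite oner_eq0.
  rewrite (eq_big_seq (fun a => fine (\int[P]_w (\1_(B a) (X a w))%:E)%E)); last first.
    by move=> a /gE ->.
  rewrite -indic_independent //; apply: eq_integral => w _; congr EFin.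
  by apply: eq_big_seq => a /gE ->.
have [al|al] := boolP (a \in l); last first.
  apply: IHl1 => // b bl bl1; apply: gB => //; rewrite in_cons negb_or bl1 andbT.
  by apply: contraNneq al => <-.
have reml b : b \in rem a l -> b \in l /\ b != a.
  by rewrite mem_rem_uniq // inE => /andP[? ?].
have ul' : uniq (rem a l) by exact: rem_uniq.
have gE : g = [eta g with a |-> g a] by apply/funext => b /=; case: eqP => // ->.
have IHrem : (\int[P]_w (\prod_(b <- rem a l) g b (X b w))%:E =
    (\prod_(b <- rem a l) fine (\int[P]_w (g b (X b w))%:E))%:E)%E.
  apply: IHl1 => // b /reml[bl ba]; [exact: lD|exact: gfin|].
  by move=> bl1; apply: gB => //; rewrite in_cons negb_or ba.
have fin_indic (B : set R) : measurable B ->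
    (\int[P]_w (\1_B (X a w))%:E)%E \is a fin_num.
  move=> mB; have mXB : measurable (X a @^-1` B).
    by rewrite -[X in measurable X]setTI; exact: mX.
  rewrite -[X in X \is a fin_num]/(\int[P]_w (\1_(X a @^-1` B) w)%:E)%E.
  by rewrite integral_indic // fin_num_measure //; exact: measurableI.
rewrite {1}gE [in RHS]gE prod_fine_update // EFinM fineK ?gfin // -IHrem.
under eq_integral => w _ do rewrite prod_update //.
apply: ge0_integral_indep => //.
- exact: measurable_prodX.
- by move=> w; apply: prodr_ge0 => b _; exact: g0.
- by rewrite IHrem.
move=> B mB; under eq_integral => w _ do rewrite -(prod_update (\1_B)) //.
rewrite IHl1 //.
- by rewrite prod_fine_update // EFinM IHrem fineK // fin_indic.
- move=> b /=; case: eqP => // _; exact/measurable_indicP.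
- by move=> b y /=; case: eqP => // _; rewrite indicE ler0n.
- by move=> b bl /=; case: eqP => [->|_]; [exact: fin_indic|exact: gfin].
- move=> b bl bl1 /=; case: eqP => [_|/eqP ba]; first by exists B.
  by apply: gB => //; rewrite in_cons negb_or ba.
Qed.

(** The functions in [l1] may take both signs; they are split one at a time into
   their positive and negative parts. *)
Let prod_independent_rec l l1 g : uniq l -> (forall a, a \in l -> D a) ->
  (forall a, measurable_fun setT (g a)) ->
  (forall a, a \in l -> P.-integrable setT (fun w => (g a (X a w))%:E)) ->
  (forall a, a \in l -> a \notin l1 -> forall y, 0 <= g a y) ->
  P.-integrable setT (fun w => (\prod_(a <- l) g a (X a w))%:E) /\
  (\int[P]_w (\prod_(a <- l) g a (X a w))%:E =
   (\prod_(a <- l) fine (\int[P]_w (g a (X a w))%:E))%:E)%E.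
Proof.
elim: l1 g => [|a l1 IHl1] g ul lD mg gint g0.
  pose g' a y := Num.max (g a y) 0.
  have gg' a : a \in l -> g a = g' a.
    by move=> al; apply/funext => y; rewrite /g' max_l // g0.
  have mg' a : measurable_fun setT (g' a).
    by apply: measurable_maxr => //; exact: measurable_cst.
  have prodE w : \prod_(a <- l) g a (X a w) = \prod_(a <- l) g' a (X a w).
    by apply: eq_big_seq => a /gg' ->.
  have intE : (\int[P]_w (\prod_(a <- l) g a (X a w))%:E =
     (\prod_(a <- l) fine (\int[P]_w (g a (X a w))%:E))%:E)%E.
    under eq_integral => w _ do rewrite prodE.
    rewrite (ge0_prod_independent (l1 := l)) //.
    - by congr EFin; apply: eq_big_seq => a /gg' ->.
    - by move=> a y; rewrite /g' le_max lexx orbT.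
    - by move=> a al; rewrite -(gg' a al); apply: integrable_fin_num => //; exact: gint.
    - by move=> a ->.
  split=> //; apply/integrableP; split; first exact/measurable_EFinP/measurable_prodX.
  rewrite (_ : (\int[P]_w _)%E = \int[P]_w (\prod_(a <- l) g a (X a w))%:E)%E; last first.
    apply: eq_integral => w _; rewrite gee0_abs // lee_fin prodE.
    by apply: prodr_ge0 => a _; rewrite /g' le_max lexx orbT.
  by rewrite intE ltry.
have [al|al] := boolP (a \in l); last first.
  apply: IHl1 => // b bl bl1; apply: g0 => //; rewrite in_cons negb_or bl1 andbT.
  by apply: contraNneq al => <-.
pose gp y := Num.max (g a y) 0; pose gm y := Num.max (- g a y) 0.
have gpm y : g a y = gp y - gm y 
  by rewrite /gp /gm; case: (lerP (g a y) 0) => ?; case: (lerP (- g a y) 0) => ?; lra.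
have mgp : measurable_fun setT gp by apply: measurable_maxr => //; exact: measurable_cst.
have mgm : measurable_fun setT gm.
  apply: measurable_maxr; last exact: measurable_cst.
  by apply: measurable_funN; exact: mg.
have part (k : R -> R) : measurable_fun setT k -> (forall y, `|k y| <= `|g a y|) ->
    (forall y, 0 <= k y) ->
    [/\ P.-integrable setT (fun w => (k (X a w))%:E),
     P.-integrable setT (fun w => (\prod_(b <- l) [eta g with a |-> k] b (X b w))%:E) &
     (\int[P]_w (\prod_(b <- l) [eta g with a |-> k] b (X b w))%:E =
      (\prod_(b <- l) fine (\int[P]_w ([eta g with a |-> k] b (X b w))%:E))%:E)%E].
  move=> mk kg k0.
  have ik : P.-integrable setT (fun w => (k (X a w))%:E).
    apply: (le_integrable _ _ _ (gint a al)) => //.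
      by apply/measurable_EFinP; exact: measurableT_comp.
    by move=> w _; rewrite /= lee_fin; exact: kg.
  have [] := IHl1 [eta g with a |-> k] ul lD.
  - by move=> b /=; case: eqP.
  - by move=> b bl /=; case: eqP => [->//|_]; exact: gint.
  - move=> b bl bl1 y /=; case: eqP => [_|/eqP ba]; first exact: k0.
    by apply: g0 => //; rewrite in_cons negb_or ba.
  by [].
have gp_le y : `|gp y| <= `|g a y| by rewrite /gp; case: (lerP (g a y) 0) => _; rewrite ?normr0.
have gp_ge0 y : 0 <= gp y by rewrite /gp le_max lexx orbT.
have gm_le y : `|gm y| <= `|g a y|.
  by rewrite /gm; case: (lerP (- g a y) 0) => _; rewrite ?normr0 ?normrN.
have gm_ge0 y : 0 <= gm y by rewrite /gm le_max lexx orbT.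
have [ip1 ip2 ip3] := part gp mgp gp_le gp_ge0.
have [im1 im2 im3] := part gm mgm gm_le gm_ge0.
have prodE w : \prod_(b <- l) g b (X b w) =
    \prod_(b <- l) [eta g with a |-> gp] b (X b w) -
    \prod_(b <- l) [eta g with a |-> gm] b (X b w).
  by rewrite !prod_update // -mulrBl -gpm (perm_big _ (perm_to_rem al)) big_cons.
split.
  under eq_fun => w do rewrite prodE EFinB.
  exact: integrableB.
under eq_integral => w _ do rewrite prodE EFinB.
rewrite integralB_EFin // ip3 im3 -EFinB; congr EFin.
rewrite !prod_fine_update // -mulrBl [RHS](perm_big _ (perm_to_rem al)) big_cons.
congr (_ * _); rewrite -fineB ?integrable_fin_num // -integralB_EFin //.
by congr fine; apply: eq_integral => w _; rewrite gpm EFinB.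
Qed.

Lemma prod_independent l g : uniq l -> (forall a, a \in l -> D a) ->
  (forall a, measurable_fun setT (g a)) ->
  (forall a, a \in l -> P.-integrable setT (fun w => (g a (X a w))%:E)) ->
  (\int[P]_w (\prod_(a <- l) g a (X a w))%:E =
   (\prod_(a <- l) fine (\int[P]_w (g a (X a w))%:E))%:E)%E.
Proof.
move=> ul lD mg gint; have [] // := @prod_independent_rec l l g ul lD mg gint.
by move=> a ->.
Qed.

End Independence.

(** * Words of labels and their moments *)

Section Unweighted.
Context (R : realType) (X : choiceType).
Implicit Types (w u v : seq X) (x : X).
Local Notation pairings := (pairing_sum (fun _ _ => 1 : R)).

Lemma count_delete_at x u (k : 'I_(size u)) y :
  count_mem y u = ((nth x u k == y) + count_mem y (delete_at u k))%N.
Proof. by rewrite (permP (perm_delete_at x (ltn_ord k))). Qed.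

Lemma pairings_cons x w u : pairings (x :: w) u = pairings w (x :: u) +
  \sum_(k < size u) (x == nth x u k)%:R * pairings w (delete_at u k).
Proof.
rewrite /=; congr (_ + _); apply: eq_bigr => k _.
by rewrite /qprefix big1_eq mulr1.
Qed.

(** Every open letter needs a partner of its own among the letters to come. *)
Lemma pairings_eq0_gt x w u : (count_mem x w < count_mem x u)%N -> pairings w u = 0.
Proof.
elim: w u => [|y w IHw] u.
  by case: u => // y u _; rewrite /=.
move=> h; rewrite pairings_cons IHw ?add0r; last by move: h => /=; lia.
rewrite big1 // => k _; have [yk|_] := eqVneq y (nth y u k); last by rewrite mul0r.
by rewrite IHw ?mulr0 //; move: h; rewrite (count_delete_at y k x) -yk /=; lia.
Qed.

Lemma pairings_eq0_odd x w u : odd (count_mem x (w ++ u)) -> pairings w u = 0.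
Proof.
elim: w u => [|y w IHw] u; first by case: u.
move=> h; rewrite pairings_cons IHw ?add0r; last first.
  by move: h; rewrite /= !count_cat /= addnCA.
rewrite big1 // => k _; have [yk|_] := eqVneq y (nth y u k); last by rewrite mul0r.
rewrite IHw ?mulr0 //; move: h; rewrite /= !(count_cat _ w) (count_delete_at y k x) -yk.
by rewrite !oddD; do 3!case: (odd _).
Qed.

(** When equal letters come in twos, the only choice is to close a pair as soon as
   possible: opening a second copy would leave two equal letters open. *)
Lemma pairings_eq1 w u : uniq u ->
  (forall x, count_mem x (w ++ u) \in [:: 0%N; 2]) -> pairings w u = 1.
Proof.
elim: w u => [|y w IHw] u uu h.
  case: u uu h => // x u /= /andP[xu _] /(_ x); rewrite eqxx.
  by rewrite (count_memPn xu).
have hx x : count_mem x (w ++ y :: u) \in [:: 0%N; 2].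
  by have := h x; rewrite /= !count_cat /= addnCA.
rewrite pairings_cons; have [yu|yu] := boolP (y \in u); last first.
  rewrite IHw //=; last by rewrite yu.
  rewrite big1 ?addr0 // => k _; case: eqP => [yk|_]; last by rewrite mul0r.
  by move: yu; rewrite yk mem_nth.
have cw : count_mem y w = 0%N.
  have := hx y; rewrite count_cat /= eqxx (count_uniq_mem _ uu) yu.
  by rewrite !inE; lia.
rewrite (pairings_eq0_gt (x := y)) ?add0r ?cw /= ?eqxx //.
have ku : (index y u < size u)%N by rewrite index_mem.
rewrite (bigD1 (Ordinal ku)) //= nth_index // eqxx mul1r.
rewrite IHw ?big1 ?addr0 //.
- move=> k kN; case: eqP => [yk|_]; last by rewrite mul0r.
  case/eqP: kN; apply/val_inj => /=; rewrite yk index_uniq //.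
- exact: (subseq_uniq (subseq_delete_at _ _)).
- move=> x; have := h x; rewrite /= !(count_cat _ w) (count_delete_at y (Ordinal ku) x) /=.
  rewrite nth_index //; have [->|_] := eqVneq y x; last by rewrite !add0n.
  by rewrite !inE; lia.
Qed.

Lemma pairings_ge0 w u : 0 <= pairings w u.
Proof.
elim: w u => [|y w IHw] u; first by rewrite /= ler0n.
by rewrite pairings_cons addr_ge0 // sumr_ge0 // => k _; rewrite mulr_ge0.
Qed.

Lemma pairings_le w u (m : nat) : (size w + size u <= m)%N ->
  pairings w u <= (m.+1 ^ size w)%:R.
Proof.
elim: w u => [|y w IHw] u; first by move=> _; rewrite /= expn0 lern1 leq_b1.
move=> h; rewrite pairings_cons.
apply: (@le_trans _ _ ((m.+1 ^ size w)%:R + \sum_(k < size u) (m.+1 ^ size w)%:R)).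
  apply: lerD; first by apply: IHw; move: h => /=; lia.
  apply: ler_sum => k _; rewrite -[leRHS]mul1r ler_pM ?pairings_ge0 //.
    by rewrite lern1 leq_b1.
  apply: IHw; rewrite size_cat size_take size_drop ltn_ord.
  by have := ltn_ord k; move: h => /=; lia.
rewrite sumr_const card_ord -mulrS -mulrnA ler_nat expnS mulnC.
by rewrite leq_mul2r; move: h => /= h; apply/orP; right; lia.
Qed.

(** The words whose moments need not equal their number of pairings; they turn out
   to be few. *)
Definition crowded v : bool :=
  all (fun x => (1 < count_mem x v)%N) v && has (fun x => (2 < count_mem x v)%N) v.

Lemma perm_crowded v v' : perm_eq v v' -> crowded v = crowded v'.
Proof.
move=> vv'; rewrite /crowded (perm_all _ vv') (perm_has _ vv').
by congr (_ && _); [apply: eq_all|apply: eq_has] => x; rewrite (permP vv').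
Qed.

End Unweighted.

Section CrowdedWords.
Context (R : realType) (I : choiceType) (L : I -> seq (seq nat)).
Context (L_gt0 : forall i, (0 < size (L i))%N) (L_uniq : forall i, uniq (L i)).
Implicit Types (u v : seq (I * seq nat)) (x : I * seq nat) (w : seq I).
Let rN i : R := (Num.sqrt (size (L i))%:R)^-1.

Let rN_gt0 i : 0 < rN i. Proof. by rewrite invr_gt0 sqrtr_gt0 ltr0n. Qed.

Context (eta : R) (eta1 : eta <= 1).

(** The two weights bound the normalized number of ways to complete the word read
   so far, [u], to a crowded one: letters seen once still have to be repeated, which
   costs a normalization each, and as long as no letter has occurred three times a
   factor [eta] is still to be gained. *)
Let simple_weight u : R :=
  \prod_(y <- undup u) (if (count_mem y u == 1)%N then rN y.1 else 1).
Let triple_weight u : R := if has (fun x => (2 < count_mem x u)%N) u then 1 else eta.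

Let simple_weight_ge0 u : 0 <= simple_weight u.
Proof. by apply: prodr_ge0 => y _; case: ifP => // _; exact: ltW. Qed.

Let weight_step u x : rN x.1 <= eta -> 
  rN x.1 * (simple_weight (x :: u) * triple_weight (x :: u)) <=
  simple_weight u * triple_weight u * (rN x.1 ^+ 2 + (count_mem x u)%:R).
Proof.
move=> rx; have eta0 : 0 <= eta by apply: le_trans rx; exact: ltW.
have t0 : 0 <= triple_weight u by rewrite /triple_weight; case: ifP.
have r0 := rN_gt0 x.1.
have cE y : y != x -> count_mem y (x :: u) = count_mem y u.
  by rewrite /= eq_sym => /negbTE->.
have cx : count_mem x (x :: u) = (count_mem x u).+1 by rewrite /= eqxx.
have [xu|xu] := boolP (x \in u); last first.
  have -> : simple_weight (x :: u) = rN x.1 * simple_weight u.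
    rewrite /simple_weight [undup _]/= (negbTE xu) big_cons cx (count_memPn xu) eqxx.
    congr (_ * _); apply: eq_big_seq => y; rewrite mem_undup => yu.
    by rewrite cE //; apply: contraNneq xu => <-.
  have -> : triple_weight (x :: u) = triple_weight u.
    rewrite /triple_weight [has _ (_ :: _)]/= eqxx (count_memPn xu) /=.
    congr (if _ then _ else _); apply: eq_in_has => y yu.
    by rewrite -[(_ + _)%N]/(count_mem y (x :: u)) cE //; apply: contraNneq xu => <-.
  by rewrite (count_memPn xu) addr0 expr2; lra.
have uxu : undup (x :: u) = undup u by rewrite /= xu.
have c1 : (0 < count_mem x u)%N by rewrite -has_count has_pred1.
have c1' : 1 <= (count_mem x u)%:R :> R by rewrite ler1n.
apply: (@le_trans _ _ (simple_weight u * triple_weight u * 1)); last first.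
  by rewrite ler_wpM2l ?mulr_ge0 // ler_wpDl ?exprn_ge0 // ltW.
rewrite mulr1; have xuu : x \in undup u by rewrite mem_undup.
have swE v' : undup v' = undup u -> simple_weight v' =
   (if (count_mem x v' == 1)%N then rN x.1 else 1) *
   \prod_(y <- undup u | y != x) (if (count_mem y v' == 1)%N then rN y.1 else 1).
  by move=> uv; rewrite /simple_weight uv (bigD1_seq x) ?undup_uniq.
rewrite (swE _ uxu) (swE u erefl) cx.
have -> : \prod_(y <- undup u | y != x) (if (count_mem y (x :: u) == 1)%N then rN y.1 else 1) =
   \prod_(y <- undup u | y != x) (if (count_mem y u == 1)%N then rN y.1 else 1).
  by apply: eq_bigr => y yx; rewrite cE.
set p := \prod_(_ <- _ | _) _; have p0 : 0 <= p.
  by apply: prodr_ge0 => y _; case: ifP => // _; exact: ltW.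
have twE : (count_mem x u != 2) -> triple_weight (x :: u) = triple_weight u.
  move=> c2; rewrite /triple_weight; congr (if _ then _ else _).
  apply/hasP/hasP => -[y yu hy].
    have [yx|yx] := eqVneq y x.
      by exists x => //; move: hy; rewrite yx cx; move: c2 c1; lia.
    exists y; last by rewrite -(cE _ yx).
    by move: yu; rewrite in_cons (negbTE yx).
  have [yx|yx] := eqVneq y x.
    by exists x; rewrite ?mem_head // cx; move: hy; rewrite yx; lia.
  by exists y; rewrite ?in_cons ?yu ?orbT // cE.
have [c_eq1|c_ne1] := eqVneq (count_mem x u) 1.
  by rewrite twE ?c_eq1 //= mul1r; lra.
have -> : ((count_mem x u).+1 == 1)%N = false by move: c1; lia.
rewrite !mul1r; have [c_eq2|c_ne2] := eqVneq (count_mem x u) 2; last first.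
  rewrite twE // mulrC -mulrA ler_wpM2l // mulrC -[leRHS]mul1r ler_wpM2r //.
  exact: le_trans eta1.
rewrite mulrC -mulrA ler_wpM2l //.
have -> : triple_weight (x :: u) = 1.
  by rewrite /triple_weight; case: hasP => // -[]; exists x; rewrite ?mem_head // cx c_eq2.
rewrite mul1r; apply: le_trans rx _; rewrite /triple_weight; case: ifP => //.
Qed.

Let crowded_sum_rec w u m : (size w + size u <= m)%N ->
  (forall i, i \in w -> rN i <= eta) -> 0 <= eta ->
  (\prod_(i <- w) rN i) * \sum_(v <- labelings L w) (crowded (v ++ u))%:R <=
  (m.+1 ^ size w)%:R * (simple_weight u * triple_weight u).
Proof.
move=> wu weta eta0; elim: w u wu weta => [|i w IHw] u wu weta.
  rewrite big_nil mul1r big_seq1 expn0 mul1r /=.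
  have t0 : 0 <= triple_weight u by rewrite /triple_weight; case: ifP.
  have [/andP[/allP c1 c2]|_] := boolP (crowded u); last by rewrite mulr_ge0.
  rewrite /triple_weight c2 mulr1 /simple_weight big1_seq // => y /=.
  by rewrite mem_undup => /c1; case: eqP => // ->.
have ri : rN i <= eta by apply: weta; exact: mem_head.
have rr : rN i ^+ 2 = (size (L i))%:R^-1.
  by rewrite exprVn sqr_sqrtr ?ler0n.
rewrite big_cons big_labelings_cons.
have step T : (\prod_(j <- w) rN j) *
    \sum_(v <- labelings L w) (crowded (((i, T) :: v) ++ u))%:R <=
    (m.+1 ^ size w)%:R * (simple_weight ((i, T) :: u) * triple_weight ((i, T) :: u)).
  under [X in _ * X]eq_bigr => v _.
    rewrite (@perm_crowded _ _ (v ++ (i, T) :: u)); first over.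
    exact/permEl/(perm_catCA [:: (i, T)] v u).
  apply: IHw => [|j jw]; first by move: wu => /=; lia.
  by apply: weta; rewrite in_cons jw orbT.
rewrite -mulrA mulr_sumr mulr_sumr.
apply: (@le_trans _ _ (\sum_(T <- L i) (m.+1 ^ size w)%:R *
   (simple_weight u * triple_weight u * (rN i ^+ 2 + (count_mem (i, T) u)%:R)))).
  apply: ler_sum => T _; apply: le_trans (ler_wpM2l (ltW (rN_gt0 i)) (step T)) _.
  by rewrite mulrCA ler_wpM2l // (@weight_step u (i, T)).
rewrite -mulr_sumr -mulr_sumr.
have -> : (m.+1 ^ size (i :: w))%:R * (simple_weight u * triple_weight u) =
    (m.+1 ^ size w)%:R * (simple_weight u * triple_weight u * m.+1%:R) :> R.
  by rewrite /= expnS natrM; ring.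
rewrite ler_wpM2l // ler_wpM2l ?mulr_ge0 //; first by rewrite /triple_weight; case: ifP.
rewrite big_split /= big_const_seq count_predT iter_addr_0 rr -[_ *+ _]mulr_natl.
rewrite mulfV ?pnatr_eq0 -?lt0n // -natr1 addrC lerD2r.
have -> : \sum_(T <- L i) (count_mem (i, T) u)%:R =
    (count (fun x => (x.1 == i) && (x.2 \in L i)) u)%:R :> R.
  elim: u {wu IHw step} => [|x u IHu] /=; first by rewrite big1.
  rewrite natrD -IHu.
  under eq_bigr => T _ do rewrite natrD.
  rewrite big_split /=; congr (_ + _).
  have [xi|xi] := eqVneq x.1 i; last first.
    by rewrite big1 // => T _; case: eqP => // xT; case/eqP: xi; rewrite xT.
  rewrite /= -xi; under eq_bigr => T _ do rewrite {1}(surjective_pairing x) xpair_eqE eqxx /=.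
  have [xL|xL] := boolP (x.2 \in L x.1).
    rewrite (bigD1_seq x.2) ?L_uniq //= eqxx big1 ?addr0 // => T.
    by rewrite eq_sym => /negbTE->.
  by rewrite big1_seq // => T /= TL; case: eqP => // xT; move: xL; rewrite xT TL.
by rewrite ler_nat (leq_trans (count_size _ _)) //; move: wu => /=; lia.
Qed.

(** A letter that is read for the first time costs the square root of its number
   of labels, and a second occurrence gains it back; a third occurrence gains
   once more. *)
Lemma crowded_sum w : (forall i, i \in w -> rN i <= eta) -> 0 <= eta ->
  (\prod_(i <- w) rN i) * \sum_(v <- labelings L w) (crowded v)%:R <=
  ((size w).+1 ^ size w)%:R * eta.
Proof.
move=> weta eta0; have := @crowded_sum_rec w [::] (size w) _ weta eta0.
rewrite addn0 => /(_ (leqnn _)).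
under [X in _ * X]eq_bigr => v _ do rewrite cats0.
by rewrite /simple_weight /triple_weight /= big_nil mul1r.
Qed.

End CrowdedWords.

Section Moments.
Context (d : measure_display) (T : measurableType d) (R : realType)
  (P : probability T R) (K : choiceType) (D : set K) (X : K -> {RV P >-> R})
  (X_indep : mutually_independent D X).
Context (X_mean : forall a, D a -> ('E_P[X a] = 0)%E)
  (X_var : forall a, D a -> ('E_P[(fun w => X a w ^+ 2)%R] = 1)%E)
  (m : nat) (C : R)
  (X_mom : forall a, D a -> (`| 'E_P[(fun w => X a w ^+ (2 * m))%R] | <= C%:E)%E).
Implicit Types v : seq K.

Definition moment v : R := fine (\int[P]_w (\prod_(a <- v) X a w)%:E)%E.

Let measurable_power a p : measurable_fun setT (fun w => X a w ^+ p).
Proof. exact: measurable_funX. Qed.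

Let even_pow_ge0 (y : R) : 0 <= y ^+ (2 * m).
Proof. by rewrite exprM exprn_ge0 // sqr_ge0. Qed.

Let integrable_top a : D a -> P.-integrable setT (fun w => (X a w ^+ (2 * m))%:E).
Proof.
move=> Da; apply/integrableP; split; first exact/measurable_EFinP/measurable_power.
have := X_mom Da; rewrite expectation.unlock => h.
rewrite (_ : (\int[P]_w _)%E = \int[P]_w (X a w ^+ (2 * m))%:E)%E; last first.
  by apply: eq_integral => w _; rewrite gee0_abs // lee_fin even_pow_ge0.
by apply: le_lt_trans (lee_abs _) _; apply: le_lt_trans h _; rewrite ltry.
Qed.

(** Through a common bound [b] of the factors that is [1] or one of them. *)
Let norm_prod_le (s : seq R) : (size s <= 2 * m)%N ->
  `|\prod_(y <- s) y| <= 1 + \sum_(y <- s) y ^+ (2 * m).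
Proof.
have [b [b1 sb hb]] : exists b : R, [/\ 1 <= b, forall y, y \in s -> `|y| <= b &
    b ^+ (2 * m) <= 1 + \sum_(y <- s) y ^+ (2 * m)].
  elim: s => [|y s [b [b1 sb hb]]].
    by exists 1; split=> //; rewrite big_nil addr0 expr1n.
  have s0 : 0 <= \sum_(y <- s) y ^+ (2 * m) by apply: sumr_ge0 => z _.
  have := even_pow_ge0 y; rewrite big_cons => y0; have [yb|yb] := leP `|y| b.
    exists b; split=> //; last by lra.
    by move=> z; rewrite inE => /orP[/eqP->|/sb].
  exists `|y|; split; first by rewrite ltW // (le_lt_trans b1).
    by move=> z; rewrite inE => /orP[/eqP->//|/sb]; move/le_trans; apply; exact: ltW.
  by rewrite -normrX ger0_norm //; lra.
move=> sm; apply: le_trans hb; rewrite normr_prod.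
apply: (@le_trans _ _ (b ^+ size s)); last by rewrite ler_weXn2l.
elim: s sb {sm} => [|y s IHs] sb; first by rewrite big_nil expr0.
rewrite big_cons exprS ler_pM ?prodr_ge0 ?sb ?mem_head // IHs // => z zs.
by rewrite sb // in_cons zs orbT.
Qed.

Let dominating v : (forall a, a \in v -> D a) ->
  P.-integrable setT (fun w => (1 + \sum_(a <- v) X a w ^+ (2 * m))%:E) /\
  (\int[P]_w (1 + \sum_(a <- v) X a w ^+ (2 * m))%:E <= (1 + (size v)%:R * C)%:E)%E.
Proof.
elim: v => [|a v IHv] vD.
  have -> : (fun w => (1 + \sum_(a <- [::]) X a w ^+ (2 * m))%:E) = (fun=> 1%:E) :> (T -> \bar R).
    by apply/funext => w; rewrite big_nil addr0.
  split; first exact: finite_measure_integrable_cst.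
  by rewrite integral_cst ?measurableT // mul0r addr0 mul1e probability_le1.
have [] := IHv; first by move=> b bv; apply: vD; rewrite in_cons bv orbT.
move=> iv hv; have Da := vD a (mem_head _ _); have ia := integrable_top Da.
have E : (fun w => (1 + \sum_(b <- a :: v) X b w ^+ (2 * m))%:E) =
    (fun w => (X a w ^+ (2 * m))%:E + (1 + \sum_(b <- v) X b w ^+ (2 * m))%:E)%E
    :> (T -> \bar R).
  by apply/funext => w; rewrite big_cons -EFinD addrCA.
rewrite E; split; first exact: integrableD.
rewrite integralD //.
have -> : 1 + (size (a :: v))%:R * C = C + (1 + (size v)%:R * C) :> R.
  by rewrite /= -natr1; ring.
rewrite EFinD leeD //; have := X_mom Da; rewrite expectation.unlock; apply: le_trans.
exact: lee_abs.
Qed.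

Lemma integrable_word v : (forall a, a \in v -> D a) -> (size v <= 2 * m)%N ->
  P.-integrable setT (fun w => (\prod_(a <- v) X a w)%:E).
Proof.
move=> vD vm; have [iv _] := dominating vD; apply: (le_integrable _ _ _ iv) => //.
  by apply/measurable_EFinP; apply: measurable_prod => a _.
move=> w _; rewrite /= lee_fin; apply: le_trans (ler_norm _).
have := @norm_prod_le [seq X a w | a <- v]; rewrite size_map !big_map; exact.
Qed.

Lemma norm_moment_le v : (forall a, a \in v -> D a) -> (size v <= 2 * m)%N ->
  `|moment v| <= 1 + (size v)%:R * C.
Proof.
move=> vD vm; have [iv hv] := dominating vD; have ip := integrable_word vD vm.
have /integrableP[mp _] := ip; have /integrableP[mv _] := iv.
rewrite -lee_fin /moment; apply: le_trans hv.
rewrite -abse_EFin fineK; last exact: integrable_fin_num.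
apply: le_trans (le_abse_integral _ _ _) _ => //.
apply: ge0_le_integral => //.
- exact: measurableT_comp.
move=> w _; rewrite lee_fin.
have := @norm_prod_le [seq X a w | a <- v]; rewrite size_map !big_map; exact.
Qed.

Lemma moment_powers v : (forall a, a \in v -> D a) -> (size v <= 2 * m)%N ->
  moment v = \prod_(a <- undup v) fine ('E_P[(fun w => X a w ^+ count_mem a v)%R]).
Proof.
move=> vD vm; rewrite /moment expectation.unlock.
have := @prod_independent _ _ _ _ _ _ _ X_indep (undup v) (fun a y => y ^+ count_mem a v).
rewrite undup_uniq => /(_ isT) h.
rewrite (_ : (\int[P]_w _)%E = \int[P]_w (\prod_(a <- undup v) X a w ^+ count_mem a v)%:E)%E.
  rewrite h; first by [].
  - by move=> a; rewrite mem_undup; exact: vD.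
  - by move=> a; exact: measurable_funX.
  move=> a; rewrite mem_undup => av.
  have := @integrable_word (nseq (count_mem a v) a).
  have -> : (fun w => (\prod_(b <- nseq (count_mem a v) a) X b w)%:E) =
      (fun w => (X a w ^+ count_mem a v)%:E) :> (T -> \bar R).
    by apply/funext => w; rewrite big_nseq iter_mulr_1.
  apply; first by move=> b /nseqP[-> _]; exact: vD.
  by rewrite size_nseq (leq_trans (count_size _ _)).
by apply: eq_integral => w _; rewrite prodr_undup_exp_count.
Qed.

(** A label occurring once makes the moment vanish, and labels occurring twice
   contribute a variance: away from crowded words the moment counts pairings. *)
Lemma moment_pairings v : (forall a, a \in v -> D a) -> (size v <= 2 * m)%N ->
  ~~ crowded v -> moment v = pairing_sum (fun _ _ => 1) v [::].
Proof.
move=> vD vm; rewrite negb_and => vN.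
have [/allPn[a av ca]|/allPn] := boolP (~~ all (fun x => (1 < count_mem x v)%N) v).
  have c1 : count_mem a v = 1%N.
    by apply/eqP; rewrite eqn_leq -ltnS ltnNge -has_count has_pred1 av andbT; move: ca; lia.
  rewrite (@pairings_eq0_odd _ _ a) ?cats0 ?c1 // moment_powers //.
  rewrite (bigD1_seq a) ?undup_uniq ?mem_undup //= c1.
  by rewrite (X_mean (vD a av)) mul0r.
move=> hall; rewrite moment_powers //.
have c2 a : a \in v -> count_mem a v = 2.
  move=> av; have := vN; case: (boolP (all _ _)) hall => [/allP hv _ /=|hv []//].
    move=> /hasPn /(_ a av); rewrite -leqNgt => c_le2.
    by apply/eqP; rewrite eqn_leq c_le2; exact: hv.
  by move/allPn: hv => [b bv hb]; exists b.
rewrite pairings_eq1 // => [|x].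
  by rewrite big1_seq // => a /=; rewrite mem_undup => av; rewrite c2 // X_var //; exact: vD.
rewrite cats0; have [xv|xv] := boolP (x \in v); first by rewrite c2.
by rewrite (count_memPn xv).
Qed.

End Moments.

(** * Passage to the limit *)

Section Limits.
Context (R : realType).

Lemma cvg_exp_extended (x : nat -> R) (lambda : \bar R) : (0 <= lambda)%E ->
  (fun n => (x n)%:E) @ \oo --> lambda ->
  (fun n => expR (- (2 * x n))) @ \oo --> fine (expeR (- (2%:E * lambda))%E).
Proof.
case: lambda => [a||//] _ xa /=; last first.
  rewrite mulr_infty gtr0_sg // mul1e /=.
  have x2 : (fun n => 2 * x n) @ \oo --> +oo.
    apply/cvgryPge => M; have xy : x @ \oo --> +oo by exact: (cvgeryP x).1 xa.
    have xM : \forall n \near \oo, M / 2 <= x n by exact: (cvgryPge x).1.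
    by apply: filterS xM => n; rewrite ler_pdivrMr // mulrC.
  exact: (cvg_comp _ _ x2 (@cvgr_expR R)).
have xa' : x @ \oo --> a by exact: (fine_cvg xa).
apply: (@continuous_cvg _ _ _ _ _ (fun n => - (2 * x n)) (@expR R)).
  exact: continuous_expR.
by apply: cvgN; apply: cvgMr.
Qed.

Lemma cvg_complex (z : nat -> R[i]) (y : R) (x b : nat -> R) :
  x @ \oo --> y -> b @ \oo --> (0 : R) ->
  (\forall n \near \oo, `|z n - ((x n)%:C)%C| <= ((b n)%:C)%C) ->
  (z : nat -> R[i]^o) @ \oo --> ((y%:C)%C : R[i]^o).
Proof.
move=> xy b0 zx; apply/cvgrPdist_lt => eps eps0.
have epsE : eps = ((complex.Re eps)%:C)%C by rewrite RRe_real // gtr0_real.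
have e0 : 0 < complex.Re eps / 2 by rewrite divr_gt0 // -ltcR -epsE.
move/cvgrPdist_lt: xy => /(_ _ e0) xy; move/cvgrPdist_lt: b0 => /(_ _ e0) b0.
near=> n.
have zxn : `|z n - ((x n)%:C)%C| <= ((b n)%:C)%C by near: n.
have xyn : `|y - x n| < complex.Re eps / 2 by near: n.
have bn : `|0 - b n| < complex.Re eps / 2 by near: n.
have -> : (y%:C)%C - z n = ((y - x n)%:C)%C - (z n - ((x n)%:C)%C).
  by rewrite rmorphB /=; ring.
apply: le_lt_trans (ler_normB _ _) _.
have -> : `|((y - x n)%:C)%C| = ((`|y - x n|)%:C)%C.
  by rewrite normc_def /= expr0n addr0 sqrtr_sqr.
apply: le_lt_trans (lerD (lexx _) zxn) _.
rewrite -rmorphD /= epsE ltcR (splitr (complex.Re eps)) ltrD //.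
by apply: le_lt_trans bn; rewrite sub0r normrN ler_norm.
Unshelve. all: by end_near.
Qed.

Lemma leq_bin n r : (0 < r < n)%N -> (n <= 'C(n, r))%N.
Proof.
elim: n r => // n IHn [//|r]; rewrite /= ltnS => rn; rewrite binS.
have b0 : (0 < 'C(n, r))%N by rewrite bin_gt0 ltnW.
have [rn'|rn'] := ltnP r.+1 n; first by have := IHn r.+1; rewrite rn' => /(_ isT); lia.
have -> : n = r.+1 by lia.
by rewrite binSn binn.
Qed.

Context (d : measure_display) (T : measurableType d) (P : probability T R).

Lemma integral_linear (V : eqType) (s : seq V) (X : V -> T -> R) (a : V -> R) :
  (forall v, v \in s -> P.-integrable setT (fun w => (X v w)%:E)) ->
  P.-integrable setT (fun w => (\sum_(v <- s) X v w * a v)%:E) /\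
  (\int[P]_w (\sum_(v <- s) X v w * a v)%:E =
   (\sum_(v <- s) fine (\int[P]_w (X v w)%:E) * a v)%:E)%E.
Proof.
elim: s => [|v s IHs] iX.
  have -> : (fun w => (\sum_(v <- [::]) X v w * a v)%:E) = (fun=> 0%:E) :> (T -> \bar R).
    by apply/funext => w; rewrite big_nil.
  rewrite big_nil integral0; split=> //; exact: integrable0.
have [is_ hs] := IHs (fun v' vs => iX v' (mem_behead (s := v :: s) vs)).
have iv := iX v (mem_head _ _).
have -> : (fun w => (\sum_(v' <- v :: s) X v' w * a v')%:E) =
    (fun w => (a v)%:E * (X v w)%:E + (\sum_(v' <- s) X v' w * a v')%:E)%E :> (T -> \bar R).
  by apply/funext => w; rewrite big_cons EFinD (mulrC (X v w)).
have iav : P.-integrable setT (fun w => (a v)%:E * (X v w)%:E)%E by exact: integrableZl.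
split; first exact: integrableD.
rewrite integralD // hs integralZl // big_cons EFinD; congr (_ + _)%E.
by rewrite mulrC EFinM fineK // integrable_fin_num.
Qed.

Lemma complex_expectation_linear (V : eqType) (s : seq V) (X : V -> T -> R)
    (t : V -> R[i]) :
  (forall v, v \in s -> P.-integrable setT (fun w => (X v w)%:E)) ->
  complex_expectation P (fun w => \sum_(v <- s) ((X v w)%:C)%C * t v) =
  \sum_(v <- s) ((fine (\int[P]_w (X v w)%:E)%E)%:C)%C * t v.
Proof.
move=> iX.
have ReE (F : V -> R) : complex.Re (\sum_(v <- s) ((F v)%:C)%C * t v) =
    \sum_(v <- s) F v * complex.Re (t v).
  elim: s {iX} => [|v s IHs]; first by rewrite !big_nil.
  by rewrite !big_cons -IHs; case: (t v) (\sum_(_ <- _) _) => a b [e f] /=; rewrite mul0r subr0.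
have ImE (F : V -> R) : complex.Im (\sum_(v <- s) ((F v)%:C)%C * t v) =
    \sum_(v <- s) F v * complex.Im (t v).
  elim: s {iX ReE} => [|v s IHs]; first by rewrite !big_nil.
  by rewrite !big_cons -IHs; case: (t v) (\sum_(_ <- _) _) => a b [e f] /=; rewrite mul0r addr0.
rewrite /complex_expectation expectation.unlock.
under eq_integral => w _ do rewrite ReE.
rewrite (integral_linear (fun v => complex.Re (t v)) iX).2.
have -> : (\int[P]_w (complex.Im (\sum_(v <- s) ((X v w)%:C)%C * t v))%:E)%E =
    (\int[P]_w (\sum_(v <- s) X v w * complex.Im (t v))%:E)%E.
  by apply: eq_integral => w _; rewrite ImE.
rewrite (integral_linear (fun v => complex.Im (t v)) iX).2 /=.
by rewrite -ReE -ImE; case: (\sum_(_ <- _) _).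
Qed.

End Limits.

(** * Expansion of products of Hamiltonians *)

Section Expansion.
Context (I : choiceType) (L : I -> seq (seq nat)).

Lemma prod_sum_labelings (B : nzRingType) (J : Type) (js : seq J) (k : J -> I)
    (g : I -> seq nat -> B) :
  \prod_(j <- js) \sum_(S <- L (k j)) g (k j) S =
  \sum_(v <- labelings L (rev [seq k j | j <- js])) \prod_(x <- rev v) g x.1 x.2.
Proof.
elim/last_ind: js => [|js j IHjs]; first by rewrite !big_nil /= big_seq1 /= big_nil.
rewrite big_rcons /= IHjs map_rcons rev_rcons big_labelings_cons exchange_big /= mulr_suml.
apply: eq_bigr => v _; rewrite mulr_sumr; apply: eq_bigr => S _.
by rewrite rev_cons big_rcons.
Qed.

End Expansion.

(** * The expected trace at fixed size *)

Section FixedSize.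
Context (R : realType) (I : choiceType) (A : I -> {fset nat}) (r : I -> nat) (n : nat).
Context (A_card : forall i, #|` A i| = n)
  (r_bounds : forall i, (0 < r i <= n)%N).
Context (M : algType R[i]) (star : M -> M) (psi : nat -> M)
  (psi_majorana : is_majorana star psi) (tr : M -> R[i])
  (tr_trace : is_normalized_trace psi tr).
Context (d : measure_display) (T : measurableType d) (P : probability T R)
  (J : I -> seq nat -> {RV P >-> R}).

Let L i := sublists (index_list (A i)) (r i).
Let rN i : R := (Num.sqrt (size (L i))%:R)^-1.
Let coupling (x : I * seq nat) : {RV P >-> R} := J x.1 x.2.

Let size_L i : size (L i) = 'C(n, r i).
Proof. by rewrite size_sublists size_index_list A_card. Qed.

Let L_gt0 i : (0 < size (L i))%N.
Proof. by rewrite size_L bin_gt0; have /andP[] := r_bounds i. Qed.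

Let L_uniq i : uniq (L i). Proof. exact/uniq_sublists/uniq_index_list. Qed.

Lemma trace_prod_hamiltonians (Z : Type) (js : seq Z) (k : Z -> I) (w : T) :
  tr (\prod_(j <- js) syk_hamiltonian psi n (A (k j)) (r (k j)) (fun s => J (k j) s w)) =
  \sum_(v <- labelings L (rev [seq k j | j <- js]))
    (((\prod_(i <- rev [seq k j | j <- js]) rN i) * \prod_(x <- v) coupling x w)%:C)%C
    * word_trace psi tr (rev v).
Proof.
pose u (i : I) (S : seq nat) : M := ((J i S w)%:C)%C *: unit_monomial psi S.
under eq_bigr => j _ do rewrite syk_hamiltonianE -size_L.
rewrite scaler_prod (prod_sum_labelings L js k u).
have gen_u v : generated psi (\prod_(x <- rev v) u x.1 x.2).
  by apply: generated_prod => x; apply: generatedZ; exact: generated_unit_monomial.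
rewrite (trZ tr_trace); last exact: generated_sum.
rewrite (tr_sum tr_trace) // mulr_sumr; apply: eq_bigr => v _.
rewrite scaler_prod (trZ tr_trace); last first.
  by apply: generated_prod => x; exact: generated_unit_monomial.
rewrite mulrA rmorphM /= !rmorph_prod /=; congr (_ * _ * _).
  by rewrite (perm_big _ (permEl (perm_rev _))) /= big_map.
by rewrite (perm_big _ (permEl (perm_rev _))).
Qed.

Context (J_indep : mutually_independent
    [set a : I * seq nat | index_tuple (A a.1) (r a.1) a.2] coupling)
  (J_mean : forall i s, index_tuple (A i) (r i) s -> ('E_P[J i s] = 0)%E)
  (J_variance : forall i s, index_tuple (A i) (r i) s ->
    ('E_P[(fun w => J i s w ^+ 2)%R] = 1)%E)
  (m : nat) (C : R) (C_ge0 : 0 <= C)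
  (J_moment : forall i s, index_tuple (A i) (r i) s ->
    (`| 'E_P[(fun w => J i s w ^+ (2 * m))%R] | <= C%:E)%E).

(** Outside crowded words the moment of the couplings counts the pairings of
   equal labels, each of which evaluates the trace to the product of the signs of
   its crossings. *)
Lemma expectation_near_pairing_avg (Z : Type) (js : seq Z) (k : Z -> I) (eta : R) :
  (size js <= 2 * m)%N -> 0 <= eta -> eta <= 1 ->
  (forall i, i \in rev [seq k j | j <- js] -> rN i <= eta) ->
  `|complex_expectation P (fun w => tr (\prod_(j <- js)
       syk_hamiltonian psi n (A (k j)) (r (k j)) (fun s => J (k j) s w)))
    - ((pairing_avg R L (rev [seq k j | j <- js]) [::])%:C)%C| <=
  (((1 + (size js)%:R * C + ((size js).+1 ^ size js)%:R)
     * (((size js).+1 ^ size js)%:R * eta))%:C)%C.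
Proof.
move=> jsm eta0 eta1 heta; set W := rev _ in heta *.
have sW : size W = size js by rewrite size_rev size_map.
set c : R := \prod_(i <- W) rN i.
have c0 : 0 <= c by apply: prodr_ge0 => i _; rewrite invr_ge0 sqrtr_ge0.
have lab v : v \in labelings L W -> size v = size js /\
    forall x, x \in v -> index_tuple (A x.1) (r x.1) x.2.
  move=> /mem_labelings[vW vL]; split; first by rewrite -sW -vW size_map.
  by move=> x /vL; rewrite mem_sublists_index_list.
pose D := [set a : I * seq nat | index_tuple (A a.1) (r a.1) a.2].
have X_mean a : D a -> ('E_P[coupling a] = 0)%E by exact: J_mean.
have X_var a : D a -> ('E_P[(fun w => coupling a w ^+ 2)%R] = 1)%E by exact: J_variance.
have X_mom a : D a -> (`| 'E_P[(fun w => coupling a w ^+ (2 * m))%R] | <= C%:E)%E.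
  exact: J_moment.
have iv v : v \in labelings L W ->
    P.-integrable setT (fun w => (\prod_(x <- v) coupling x w)%:E).
  by move=> /lab[sv vD]; apply: (integrable_word X_mom); rewrite ?sv.
have -> : (fun w => tr (\prod_(j <- js)
     syk_hamiltonian psi n (A (k j)) (r (k j)) (fun s => J (k j) s w))) =
   (fun w => \sum_(v <- labelings L W)
     ((c * \prod_(x <- v) coupling x w)%:C)%C * word_trace psi tr (rev v)).
  by apply/funext => w; rewrite trace_prod_hamiltonians.
rewrite complex_expectation_linear; last first.
  by move=> v /iv; exact: integrableZl.
have -> : \sum_(v <- labelings L W)
    ((fine (\int[P]_w (c * \prod_(x <- v) coupling x w)%:E)%E)%:C)%C
      * word_trace psi tr (rev v) =
    \sum_(v <- labelings L W) ((c * moment coupling v)%:C)%C * word_trace psi tr (rev v).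
  apply: eq_big_seq => v /iv iv'; congr ((_%:C)%C * _).
  have -> : (\int[P]_w (c * \prod_(x <- v) coupling x w)%:E =
     c%:E * \int[P]_w (\prod_(x <- v) coupling x w)%:E)%E by rewrite -integralZl.
  by rewrite fineM // integrable_fin_num.
have -> : ((pairing_avg R L W [::])%:C)%C = \sum_(v <- labelings L W)
    ((c * pairing_sum (fun _ _ => 1) v [::])%:C)%C * word_trace psi tr (rev v).
  rewrite /pairing_avg big_nil mulr1 -/c mulr_sumr rmorph_sum /=.
  apply: eq_big_seq => v /lab[_ vD]; rewrite !rmorphM /= -mulrA; congr (_ * _).
  rewrite -(word_trace_pairing psi_majorana tr_trace) //; first by rewrite cats0 mulrC.
  move=> x /vD; rewrite -mem_sublists_index_list mem_sublists => /andP[xs _].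
  exact: subseq_uniq xs (uniq_index_list _).
rewrite -sumrB; set B : R := 1 + _ + _.
have B0 v : v \in labelings L W ->
    `|moment coupling v - pairing_sum (fun _ _ => 1) v [::]| <= B * (crowded v)%:R.
  move=> /lab[sv vD]; have [vc|vc] := boolP (crowded v); last first.
    by rewrite (moment_pairings J_indep X_mean X_var X_mom) ?subrr ?normr0 ?mulr0 ?sv.
  rewrite mulr1; apply: le_trans (ler_normB _ _) _; apply: lerD.
    by rewrite -sv; apply: (norm_moment_le X_mom); rewrite ?sv.
  rewrite ger0_norm ?pairings_ge0 // -sv.
  by apply: pairings_le; rewrite addn0.
apply: le_trans (ler_norm_sum _ _ _) _.
apply: (@le_trans _ _ (((\sum_(v <- labelings L W) c * (B * (crowded v)%:R))%:C)%C)).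
  rewrite rmorph_sum /= big_seq [leRHS]big_seq; apply: ler_sum => v vW.
  rewrite -mulrBl -rmorphB /= -mulrBr normrM -[leRHS]mulr1.
  apply: ler_pM => //; last exact: (norm_word_trace psi_majorana tr_trace).
  rewrite normc_def /= expr0n addr0 sqrtr_sqr lecR normrM ger0_norm //.
  by rewrite ler_wpM2l // B0.
rewrite lecR; under eq_bigr => v _ do rewrite mulrCA.
have B_ge0 : 0 <= B by rewrite !addr_ge0 ?mulr_ge0.
rewrite -mulr_sumr -mulr_sumr ler_wpM2l // -sW.
exact: crowded_sum.
Qed.

End FixedSize.

(** * Convergence in distribution *)

(* Since 1 <= r k 1 <= 1, requiring r k 1 to have the parity of the other
   r k n would make every r k n odd: the parity assumption (and the formula for
   q) is therefore only imposed for n >= 2, which is implied by the version with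
   n >= 1 and also covers even r k n. *)
Theorem theorem1p2 (R : realType) (I : choiceType)
  (A : I -> nat -> {fset nat}) (r : I -> nat -> nat)
  (A_card : forall k n, (0 < n)%N -> #|` A k n| = n)
  (r_bounds : forall k n, (0 < n)%N -> (0 < r k n <= n)%N)
  (r_small : forall k, (fun n => (r k n)%:R / n%:R : R) @ \oo --> (0 : R))
  (r_parity : forall k m n, (1 < m)%N -> (1 < n)%N ->
     odd (r k m) = odd (r k n))
  (M : algType R[i]) (star : M -> M) (M_star : is_star star)
  (psi : nat -> M) (psi_majorana : is_majorana star psi)
  (tr : M -> R[i]) (tr_trace : is_normalized_trace psi tr)
  (d : measure_display) (T : measurableType d) (P : probability T R)
  (J : nat -> I -> seq nat -> {RV P >-> R})
  (J_indep : forall n, (0 < n)%N ->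
     mutually_independent
       [set a : I * seq nat | index_tuple (A a.1 n) (r a.1 n) a.2]
       (fun a => J n a.1 a.2))
  (J_mean : forall n k s, (0 < n)%N -> index_tuple (A k n) (r k n) s ->
     ('E_P[J n k s] = 0)%E)
  (J_variance : forall n k s, (0 < n)%N -> index_tuple (A k n) (r k n) s ->
     ('E_P[(fun w => J n k s w ^+ 2)%R] = 1)%E)
  (J_moments : forall p : nat, (3 <= p)%N -> exists C : R,
     forall n k s, (0 < n)%N -> index_tuple (A k n) (r k n) s ->
     (`| 'E_P[(fun w => J n k s w ^+ p)%R] | <= C%:E)%E)
  (lambda : I -> I -> \bar R)
  (lambda_ge0 : forall i j, (0 <= lambda i j)%E)
  (lambda_lim : forall i j,
     (fun n => ((r i n)%:R * (r j n)%:R / n%:R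
                * (#|` A i n `&` A j n|%fset%:R / n%:R) : R)%:E)
       @ \oo --> lambda i j)
  (q : I -> I -> R)
  (q_def : forall i j n, (1 < n)%N ->
     q i j = (-1) ^+ (r i n * r j n) * fine (expeR (- (2%:E * lambda i j))%E))
  (l : nat) (l_gt0 : (0 < l)%N) (k : 'I_l -> I) :
  (fun n => complex_expectation P (fun w =>
     tr (\prod_(j < l)
           syk_hamiltonian psi n (A (k j) n) (r (k j) n)
             (fun s => J n (k j) s w))) : R[i]^o)
    @ \oo --> (vacuum_state q (\big[comp/idfun]_(j < l) qgaussian q (k j)) : R[i]^o).
Proof.
pose i0 := k (Ordinal l_gt0).
pose js := index_enum 'I_l; pose W := rev [seq k j | j <- js].
have size_js : size js = l by rewrite -sum1_size sum_nat_const card_ord muln1.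
have size_W : size W = l by rewrite size_rev size_map.
pose sA n i := index_list (A i n); pose rr n i := r i n.
have sA_uniq n i : uniq (sA n i) by exact: uniq_index_list.
have sA_size n i : (0 < n)%N -> size (sA n i) = n.
  by move=> n0; rewrite size_index_list A_card.
have rr_bounds n i : (0 < n)%N -> (0 < rr n i <= n)%N by exact: r_bounds.
have q_lim i j : (fun n => (-1) ^+ (rr n i * rr n j)
     * expR (- (2 * ((rr n i)%:R * (rr n j)%:R / n%:R
         * ((count (mem (sA n j)) (sA n i))%:R / n%:R))))) @ \oo --> q i j.
  have overlap n : count (mem (sA n j)) (sA n i) = #|` A i n `&` A j n|%fset.
    rewrite -size_filter; apply/perm_size/uniq_perm; rewrite ?filter_uniq ?fset_uniq //.
    by move=> a; rewrite mem_filter !inE !mem_index_list andbC.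
  rewrite (q_def i j 2%N (ltnSn 1)).
  have signE : \forall n \near \oo, (-1) ^+ (r i 2 * r j 2) *
      expR (- (2 * ((r i n)%:R * (r j n)%:R / n%:R
         * (#|` A i n `&` A j n|%fset%:R / n%:R)))) = (-1) ^+ (rr n i * rr n j)
     * expR (- (2 * ((rr n i)%:R * (rr n j)%:R / n%:R
         * ((count (mem (sA n j)) (sA n i))%:R / n%:R)))) :> R.
    near=> n; rewrite overlap -[in LHS]signr_odd -[in RHS]signr_odd !oddM.
    have n1 : (1 < n)%N by near: n; exact: nbhs_infty_gt.
    by rewrite /rr (r_parity i 2%N n (ltnSn 1) n1) (r_parity j 2%N n (ltnSn 1) n1).
  apply: cvg_trans (near_eq_cvg signE) _; apply: cvgMr.
  exact: cvg_exp_extended (lambda_ge0 i j) (lambda_lim i j).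
pose K a := nth i0 W a.
have KW : [seq K j | j <- iota 0 l] = W.
  by rewrite /K map_nth_iota0 ?size_W // -size_W take_size.
pose LL n i := sublists (sA n i) (rr n i).
have lim_pairings : (fun n => pairing_avg R (LL n) W [::]) @ \oo --> pairing_sum q W [::].
  have -> : pairing_sum q W [::] = \prod_(e <- [::] : seq (nat * nat)) q (K e.1) (K e.2) *
      pairing_sum q [seq K j | j <- iota 0 l] [seq K a | a <- [::]].
    by rewrite big_nil mul1r KW.
  apply: cvg_ext (@pairing_avg_lim _ _ sA rr sA_uniq sA_size rr_bounds r_small q q_lim
    K l 0 [::] [::] _ _ _ _ _) => // n.
  by rewrite /= big_nil mul1r KW.
(* A vanishing upper bound of [1 / sqrt 'C(n, r)], since [n <= 'C(n, r)] when
   [0 < r < n] and [1 <= r i0 n]. *)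
pose dl n : R := Num.sqrt ((r i0 n)%:R / n%:R).
have dl0 : dl @ \oo --> (0 : R).
  rewrite -(@sqrtr0 R); apply: continuous_cvg; [exact: sqrt_continuous|exact: r_small].
(* An even exponent that is at least the length of the word and at least [3]. *)
have [|C hC] := J_moments (2 * l.+2)%N; first by lia.
pose C0 := Num.max C 0.
rewrite vacuum_state_pairing_sum -/js -/W.
apply: (cvg_complex lim_pairings (b := fun n =>
  (1 + (size js)%:R * C0 + ((size js).+1 ^ size js)%:R)
     * (((size js).+1 ^ size js)%:R * dl n))).
  rewrite -[X in _ --> X](mulr0 (1 + (size js)%:R * C0 + ((size js).+1 ^ size js)%:R)).
  apply: cvgMr; rewrite -[X in _ --> X](mulr0 ((size js).+1 ^ size js)%:R).
  exact: cvgMr.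
near=> n.
have n0 : (0 < n)%N by near: n; exact: nbhs_infty_gt.
have n0' : (0 : R) < n%:R by rewrite ltr0n.
have rW j : (2 * r (k j) n <= n)%N.
  move: j; near: n; apply: filter_forall => j; exact: near_small.
have C0_ge0 : 0 <= C0 by rewrite le_max lexx orbT.
have J_moment i s : index_tuple (A i n) (r i n) s ->
    (`| 'E_P[(fun w => J n i s w ^+ (2 * l.+2))%R] | <= C0%:E)%E.
  by move=> /(hC n i s n0) /le_trans; apply; rewrite lee_fin le_max lexx.
apply: (@expectation_near_pairing_avg R I (A^~ n) (r^~ n) n
  (fun i => A_card i n n0) (fun i => r_bounds i n n0) M star psi psi_majorana
  tr tr_trace d T P (J n) (J_indep n n0) (fun i s => J_mean n i s n0)
  (fun i s => J_variance n i s n0) l.+2 C0 C0_ge0 J_moment).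
- by rewrite size_js; lia.
- exact: sqrtr_ge0.
- rewrite -(@sqrtr1 R) ler_wsqrtr // ler_pdivrMr // mul1r ler_nat.
  by have /andP[] := r_bounds i0 n n0.
move=> i; rewrite mem_rev => /mapP[j _ ->].
have /andP[r0 rn] := r_bounds (k j) n n0; have := rW j => r2.
rewrite size_sublists size_index_list A_card // -sqrtrV ?ler0n // ler_wsqrtr //.
apply: (@le_trans _ _ (n%:R^-1)).
  rewrite lef_pV2 ?posrE ?ltr0n ?bin_gt0 // ler_nat leq_bin //.
  by rewrite r0; lia.
rewrite -[leLHS]mul1r ler_wpM2r ?invr_ge0 ?ler0n // ler1n.
by have /andP[] := r_bounds i0 n n0.
Unshelve. all: by end_near.
Qed.
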